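(* Let $(g_i)_{i\ge1}$ be independent random elements of $\mathrm{Br}_3$, each uniformly distributed on $\{\sigma_1,\sigma_2\}$, and let $w_n = g_1 g_2\cdots g_n$. Set $\ell_0 = (5-\sqrt5)/4$. There exists $\nu_0 > 0$ such that for any real $a < b$, $$\mathbb{P}\left( \frac{|\sigma_{\widehat{w}_n}(-1)| - \ell_0 n}{\nu_0\sqrt{n}} \in [a,b]\right) \longrightarrow \frac{1}{\sqrt{2\pi}}\int_a^b e^{-t^2/2}\,dt \qquad (n\to\infty).$$
   Context: $\mathrm{Br}_3 = \langle \sigma_1, \sigma_2 \mid \sigma_1\sigma_2\sigma_1 = \sigma_2\sigma_1\sigma_2\rangle$ is the 3-strand braid group, and $\widehat{w}$ is the oriented link in $S^3$ that is the braid closure of $w$ (all strands oriented in parallel). For an oriented link $L$ with Seifert matrix $V_L$, the signature function $\sigma_L : S^1\to\mathbb{Z}$ assigns to $\omega\in S^1$ the signature of the Hermitian matrix $(1-\omega)V_L + (1-\omega^{-1})V_L^{t}$; thus $\sigma_L(-1)$ is the usual (Murasugi) signature of $L$, the signature of $V_L+V_L^t$. *)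

(* Defs.v *)
From HB Require Import structures.
From mathcomp Require Import all_boot all_order all_algebra all_fingroup.
From mathcomp Require Import generic_quotient.
From mathcomp Require Import complex.
From mathcomp Require Import all_classical all_reals all_analysis.
Set Implicit Arguments.
Unset Strict Implicit.
Unset Printing Implicit Defensive.
Import Order.TTheory GRing.Theory Num.Theory.
Import numFieldNormedType.Exports.

Local Open Scope classical_set_scope.
Local Open Scope ring_scope.

(* [(ord0, b)] and [(ord_max, b)] stand for sigma_1 and sigma_2 when [b] is
   [true], and for their inverses when [b] is [false]. *)
Definition letter : Type := ('I_2 * bool)%type.
Definition word : Type := seq letter.

HB.instance Definition _ := Choice.on letter.
HB.instance Definition _ := Choice.on word.

Definition s1 : letter := (ord0, true).
Definition s2 : letter := (ord_max, true).

Inductive braid_equiv : word -> word -> Prop :=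
| braid_refl u : braid_equiv u u
| braid_sym u v : braid_equiv u v -> braid_equiv v u
| braid_trans u v w : braid_equiv u v -> braid_equiv v w -> braid_equiv u w
| braid_cat u u' v v' :
    braid_equiv u u' -> braid_equiv v v' -> braid_equiv (u ++ v) (u' ++ v')
| braid_cancel i b : braid_equiv [:: (i, b); (i, ~~ b)] [::]
| braid_relation : braid_equiv [:: s1; s2; s1] [:: s2; s1; s2].

Definition braid_equivb : rel word := fun u v => `[< braid_equiv u v >].

Lemma braid_equivb_refl : reflexive braid_equivb.
Proof. by move=> u; apply/asboolP; exact: braid_refl. Qed.

Lemma braid_equivb_sym : symmetric braid_equivb.
Proof. by move=> u v; apply/asboolP/asboolP; exact: braid_sym. Qed.

Lemma braid_equivb_trans : transitive braid_equivb.
Proof.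
by move=> v u w /asboolP uv /asboolP vw; apply/asboolP; exact: braid_trans vw.
Qed.

Canonical braid_equiv_rel := EquivRel braid_equivb
  braid_equivb_refl braid_equivb_sym braid_equivb_trans.

Definition Br3 : Type := {eq_quot braid_equivb}%qT.
HB.instance Definition _ := Choice.on Br3.
HB.instance Definition _ := EqQuotient.on Br3.

Definition braid (u : word) : Br3 := (\pi_Br3 u)%qT.

Lemma braidP (u v : word) : braid u = braid v <-> braid_equiv u v.
Proof.
split=> [/eqmodP|uv]; first by rewrite /= => /asboolP.
by apply/eqmodP => /=; apply/asboolP.
Qed.

Lemma repr_braidP (u : word) : braid_equiv (repr (braid u)) u.
Proof. by apply/braidP; rewrite /braid reprK. Qed.

Definition word_inv (u : word) : word := [seq (x.1, ~~ x.2) | x <- rev u].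

Definition braid_one : Br3 := braid [::].
Definition braid_mul (x y : Br3) : Br3 := braid (repr x ++ repr y).
Definition braid_inv (x : Br3) : Br3 := braid (word_inv (repr x)).

Lemma braid_mulE (u v : word) : braid_mul (braid u) (braid v) = braid (u ++ v).
Proof. by apply/braidP/braid_cat; exact: repr_braidP. Qed.

Lemma braid_reprK (x : Br3) : braid (repr x) = x.
Proof. exact: reprK. Qed.

Lemma braid_mulA : associative braid_mul.
Proof.
move=> x y z; rewrite -(braid_reprK x) -(braid_reprK y) -(braid_reprK z).
by rewrite !braid_mulE catA.
Qed.

Lemma braid_mul1 : left_id braid_one braid_mul.
Proof. by move=> x; rewrite -(braid_reprK x) braid_mulE. Qed.

Lemma braid_mulr1 : right_id braid_one braid_mul.
Proof. by move=> x; rewrite -(braid_reprK x) braid_mulE cats0. Qed.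

Lemma word_invK : involutive word_inv.
Proof.
move=> u; rewrite /word_inv -map_rev revK -map_comp -[RHS]map_id.
by apply: eq_map => -[i b] /=; rewrite negbK.
Qed.

Lemma word_mulV (u : word) : braid_equiv (u ++ word_inv u) [::].
Proof.
elim: u => [|[i b] u IHu]; first exact: braid_refl.
rewrite /word_inv rev_cons map_rcons -cats1 /= catA -cat1s.
apply: braid_trans (braid_cancel i b); rewrite -[X in braid_equiv _ X]cat1s.
apply: braid_cat; first exact: braid_refl.
by rewrite -[X in braid_equiv _ X]cat0s; apply: braid_cat => //; exact: braid_refl.
Qed.

Lemma braid_mulxV : right_inverse braid_one braid_inv braid_mul.
Proof.
move=> x; rewrite -{1}(braid_reprK x) /braid_inv braid_mulE.
exact/braidP/word_mulV.
Qed.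

Lemma braid_mulVx : left_inverse braid_one braid_inv braid_mul.
Proof.
move=> x; rewrite -{2}(braid_reprK x) /braid_inv braid_mulE.
by apply/braidP; rewrite -{2}(word_invK (repr x)); exact: word_mulV.
Qed.

HB.instance Definition _ := isGroup.Build Br3
  braid_mulA braid_mul1 braid_mulr1 braid_mulVx braid_mulxV.

Definition sigma1 : Br3 := braid [:: s1].
Definition sigma2 : Br3 := braid [:: s2].

HB.instance Definition _ := isPointed.Build Br3 braid_one.
HB.instance Definition _ := @isMeasurable.Build default_measure_display
  Br3 discrete_measurable discrete_measurable0
  discrete_measurableC discrete_measurableU.

(* The closure of a word bounds the surface F made of three parallel disks
   D_0, D_1, D_2 stacked along the braid axis, all oriented upwards, together
   with one half-twisted band for each letter (i, b), joining D_i to D_(i+1);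
   the position of a letter in the word is the angular position of its band,
   and [b = true] is a positive crossing.  For a band p, let q be the next band
   in the same column i; the pairs (p, q) index a basis of H_1(F): the loop of
   (p, q) goes up band p, across D_(i+1), down band q and back across D_i. *)

Definition column (w : word) (p : nat) : 'I_2 := (nth s1 w p).1.
Definition positive (w : word) (p : nat) : bool := (nth s1 w p).2.
Definition crossing_sign (w : word) (p : nat) : int :=
  if positive w p then 1 else - 1.

Definition next_band (w : word) (p q : nat) : bool :=
  [&& (p < q)%N, column w q == column w p
    & all (fun r => column w r != column w p) (iota p.+1 (q - p.+1))].

Definition loops (w : word) : seq (nat * nat) :=
  [seq x <- [seq (p, q) | p <- iota 0 (size w), q <- iota 0 (size w)]
     | next_band w x.1 x.2].

(* The linking number of the loop x with the push-off of the loop y in the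
   positive normal direction of F.
   - A loop has self-linking minus half the sum of its two crossing signs.
   - Two loops of a column that meet do so along one band, at which the push-off
     of the earlier loop links the later one once if that crossing is positive,
     and the push-off of the later loop links the earlier one -1 times if it is
     negative.
   - A loop of column 0 and a loop of column 1 meet on the disk D_1 only, and
     cross there exactly when their bands interleave; there the push-off lifts
     the loop of column 0 above the loop of column 1. *)
Definition linking (w : word) (x y : nat * nat) : int :=
  if x == y then
    - ((crossing_sign w x.1 + crossing_sign w x.2) %/ 2)%Z
  else if column w x.1 == column w y.1 then
    if y.2 == x.1 then (if positive w x.1 then 1 else 0)
    else if x.2 == y.1 then (if positive w y.1 then 0 else - 1)
    else 0
  else if (column w y.1 < column w x.1)%N then
    if [&& (y.1 < x.1)%N, (x.1 < y.2)%N & (y.2 < x.2)%N] then 1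
    else if [&& (x.1 < y.1)%N, (y.1 < x.2)%N & (x.2 < y.2)%N] then - 1
    else 0
  else 0.

(* If one of the two generators does not occur in [w], the surface F is not
   connected; tubing its components together borders the matrix below with zero
   rows and columns, which leaves the signatures unchanged. *)
Definition seifert_matrix (w : word) : 'M[int]_(size (loops w)) :=
  \matrix_(i, j) linking w (nth (0, 0)%N (loops w) i) (nth (0, 0)%N (loops w) j).

Definition signature (C : numClosedFieldType) (n : nat) (A : 'M[C]_n) : int :=
  #|[set i | 0 < spectral_diag A ord0 i]|%:Z
  - #|[set i | spectral_diag A ord0 i < 0]|%:Z.

Definition word_signature (C : numClosedFieldType) (w : word) (omega : C) : int :=
  let V := map_mx (intr : int -> C) (seifert_matrix w) in
  signature ((1 - omega) *: V + (1 - omega^-1) *: V^T).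

(* The signature function of the closure of the braid x; it is an invariant of
   the closed braid, so the choice of a word representing x is immaterial. *)
Definition closure_signature (C : numClosedFieldType) (x : Br3) (omega : C) : int :=
  word_signature (repr x) omega.

Section RandomElements.
Context d d' (T : measurableType d) (S : measurableType d') (R : realType).
Variable P : probability T R.

Definition mutually_independent (X : nat -> {RV P >-> S}) : Prop :=
  forall (J : seq nat) (B : nat -> set S), uniq J ->
    (forall j, measurable (B j)) ->
    P (\bigcap_(j in [set` J]) (X j @^-1` B j))
      = (\prod_(j <- J) P (X j @^-1` B j))%E.

Definition uniform_on_pair (x y : S) (X : {RV P >-> S}) : Prop :=
  forall B : set S, measurable B ->
    distribution P X B = ((2^-1)%:E * (\d_x B + \d_y B))%E.

End RandomElements.

Definition random_product (T : Type) (G : groupType) (g : nat -> T -> G)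
    (n : nat) (t : T) : G :=
  (\prod_(i < n) g i t)%g.

(* Main.v *)
Require Import Defs.
From HB Require Import structures.
From mathcomp Require Import all_boot all_order all_algebra all_fingroup.
From mathcomp Require Import complex.
From mathcomp Require Import all_classical all_reals all_analysis.
From mathcomp Require Import ring lra zify.
Import Order.TTheory GRing.Theory Num.Theory.
Import numFieldNormedType.Exports.

Set Implicit Arguments.
Unset Strict Implicit.
Unset Printing Implicit Defensive.

Local Open Scope classical_set_scope.
Local Open Scope ring_scope.

(** The signature of the closure of a 3-braid word is, up to a bounded error,
a function of a normal form in the braid group; along a random positive word
that function is an additive functional of a positive recurrent Markov chain,
and its fluctuations are therefore Gaussian.

Algebra.  A word is read as a planar lattice path: a letter of column 0 moves
the first coordinate by an unknown amount, a letter of column 1 the second one.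
The symmetrized Seifert form of the closure is, on closed paths based at the
origin, the Hermitian form [path_form]: each step contributes its square with
minus the sign of the crossing, and the interaction of two columns is the area swept
by the path ([word_signature_sig], which compares the two forms up to four
linear constraints).  Letting the base point vary gives a form whose signature
[sig] depends on the braid only ([sig_braid]: the braid relation is a linear
change of variables, a cancelling pair a hyperbolic plane), and is additive up
to a constant under concatenation ([sig_cat]).

Every positive braid is the product of an alternating word, in which one
generator occurs positively and the other one negatively, and of a power
[Delta ^+ j] of the half twist.  The signature of an alternating word is,
up to a constant, its number of negative letters minus its number of positive
ones; that of [Delta ^+ j] is [- 2 j] up to a constant.  So [sig] is minus the
height of the normal form, within a constant ([sig_run]).

Dynamics.  Multiplying a normal form by a generator pushes a sign on a stack,
or modifies the top of the stack: a positive top becomes negative, a negative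
one disappears, and the commutation of generators with [Delta] only exchanges
their names, which a fair coin does not see ([mean_height]).  Read from its
last letter, a word acts on stacks as a fixed gain followed by a number
[defect] of pops ([gain_score]); adding a letter on the left of the word
increases the defect by one or decreases it by at most two.  This chain has drift
[- 1/2], and its stationary law is geometric with golden ratio, whence the
speed [(5 - Num.sqrt 5) / 4].

Probability.  An explicit solution of the Poisson equation turns the gain into
a martingale ([centered]) with increments [+- jump]; a second one
([corrector]) replaces the squared increments by their stationary average
[variance].  The central limit theorem follows by running the heat equation
backwards along the martingale ([smooth_clt]); the initial datum is a Gaussian
kernel of small width, which sandwiches the indicator of an interval
([letter_clt]). *)

(** * Inertia of Hermitian forms *)

Section Inertia.
Variable C : numClosedFieldType.

(** The two bounds on the positive index are witnessed by linear maps rather than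
by dimensions of subspaces: they make sense on spaces of infinite dimension,
such as streams, and transport along linear maps. *)
Definition pos_ge (V : lmodType C) (q : V -> C) (k : nat) :=
  exists f : 'rV[C]_k -> V, linear f /\ forall x, x != 0 -> 0 < q (f x).

Definition pos_le (V : lmodType C) (q : V -> C) (k : nat) :=
  exists g : V -> 'rV[C]_k, linear g /\ forall x, g x = 0 -> q x <= 0.

Definition has_pos (V : lmodType C) (q : V -> C) (k : nat) :=
  pos_ge q k /\ pos_le q k.

Lemma linear_at0 (U V : lmodType C) (f : U -> V) : linear f -> f 0 = 0.
Proof.
by move=> /(_ (-1) 0 0); rewrite scaler0 addr0 scaleN1r addNr.
Qed.

Lemma linear_kernel (j k : nat) (h : 'rV[C]_j -> 'rV[C]_k) :
  linear h -> (k < j)%N -> exists2 x, x != 0 & h x = 0.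
Proof.
move=> hlin ltkj.
pose H : {linear 'rV[C]_j -> 'rV[C]_k} :=
  HB.pack h (GRing.isLinear.Build _ _ _ _ h hlin).
(* by the rank theorem, as there are fewer equations than unknowns *)
have rk : (0 < \rank (kermx (lin1_mx H)))%N.
  by rewrite mxrank_ker subn_gt0 (leq_ltn_trans (rank_leq_col _)).
have /rowV0Pn [x xK x0] : kermx (lin1_mx H) != 0 by rewrite -mxrank_eq0 -lt0n.
exists x => //; have /sub_kermxP := xK.
by rewrite mul_rV_lin1.
Qed.

(** A positive definite subspace meets the kernel of the functionals that make
the form nonpositive only at the origin. *)
Lemma pos_ge_le (V : lmodType C) (q : V -> C) (j k : nat) :
  pos_ge q j -> pos_le q k -> (j <= k)%N.
Proof.
move=> [f [flin fpos]] [g [glin gneg]]; rewrite leqNgt; apply/negP => ltkj.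
have [a x y|x x0 /gneg] := @linear_kernel j k (g \o f) _ ltkj.
  by rewrite /= flin glin.
by move: (fpos x x0) => /lt_le_trans h /h; rewrite ltxx.
Qed.

Lemma pos_le_pullback (V1 V2 : lmodType C) (q1 : V1 -> C) (q2 : V2 -> C)
    (phi : V1 -> V2) (m k : nat) (g0 : V1 -> 'rV[C]_m) :
  linear phi -> linear g0 ->
  (forall x, g0 x = 0 -> q1 x <= q2 (phi x)) ->
  pos_le q2 k -> pos_le q1 (k + m).
Proof.
move=> plin g0lin le12 [g [glin gneg]].
exists (fun x => row_mx (g (phi x)) (g0 x)); split=> [a x y|x].
  by rewrite plin glin g0lin scale_row_mx add_row_mx.
rewrite -row_mx0 => /eq_row_mx[/gneg le2 /le12 le1]; exact: le_trans le1 le2.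
Qed.

(** How indices are compared throughout: an inequality between two forms that
holds on the kernel of [m] functionals costs at most [m]. *)
Lemma pos_comparison (V1 V2 : lmodType C) (q1 : V1 -> C) (q2 : V2 -> C)
    (phi : V1 -> V2) (m k1 k2 : nat) (g0 : V1 -> 'rV[C]_m) :
  linear phi -> linear g0 ->
  (forall x, g0 x = 0 -> q1 x <= q2 (phi x)) ->
  has_pos q1 k1 -> has_pos q2 k2 -> (k1 <= k2 + m)%N.
Proof.
move=> plin g0lin le12 [ge1 _] [_ le2].
exact: pos_ge_le ge1 (pos_le_pullback plin g0lin le12 le2).
Qed.

Lemma has_pos_sum (V1 V2 : lmodType C) (q1 : V1 -> C) (q2 : V2 -> C)
    (k1 k2 : nat) : q1 0 = 0 -> q2 0 = 0 ->
  has_pos q1 k1 -> has_pos q2 k2 ->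
  has_pos (fun x : (V1 * V2)%type => q1 x.1 + q2 x.2) (k1 + k2).
Proof.
move=> q10 q20 [[f1 [f1lin f1pos]] [g1 [g1lin g1neg]]].
move=> [[f2 [f2lin f2pos]] [g2 [g2lin g2neg]]].
have f10 := linear_at0 f1lin; have f20 := linear_at0 f2lin.
split.
  exists (fun x => (f1 (lsubmx x), f2 (rsubmx x))); split=> [a x y|x x0 /=].
    by rewrite !linearP f1lin f2lin.
  have [l0|l0] := eqVneq (lsubmx x) 0; last first.
    have [r0|r0] := eqVneq (rsubmx x) 0; last by rewrite addr_gt0 ?f1pos ?f2pos.
    by rewrite r0 f20 q20 addr0 f1pos.
  have [r0|r0] := eqVneq (rsubmx x) 0; last by rewrite l0 f10 q10 add0r f2pos.
  by move: x0; rewrite -(hsubmxK x) l0 r0 row_mx0 eqxx.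
exists (fun x => row_mx (g1 x.1) (g2 x.2)); split=> [a x y|x].
  by rewrite scale_row_mx add_row_mx -g1lin -g2lin.
by rewrite -row_mx0 => /eq_row_mx[/g1neg ? /g2neg ?]; rewrite -oppr_ge0 opprD addr_ge0 ?oppr_ge0.
Qed.

Lemma has_pos_norm : has_pos (fun a : C^o => a * a^*) 1.
Proof.
split.
  exists (fun x : 'rV[C]_1 => x 0 0 : C^o); split=> [a x y|x x0].
    by rewrite !mxE.
  rewrite mul_conjC_gt0; apply: contra_neq x0 => x0.
  by apply/rowP => i; rewrite ord1 x0 mxE.
exists (fun a : C^o => \row_(i < 1) a); split=> [a x y|x].
  by apply/rowP => i; rewrite !mxE.
by move=> /rowP/(_ 0); rewrite !mxE => ->; rewrite mul0r.
Qed.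

Lemma has_pos_isometry (V1 V2 : lmodType C) (q1 : V1 -> C) (q2 : V2 -> C)
    (phi : V1 -> V2) (psi : V2 -> V1) (k : nat) :
  linear phi -> linear psi -> (forall x, q2 (phi x) = q1 x) ->
  (forall y, q1 (psi y) = q2 y) -> has_pos q1 k -> has_pos q2 k.
Proof.
move=> plin slin qp qs [[f [flin fpos]] [g [glin gneg]]]; split.
  exists (phi \o f); split=> [a x y|x x0] /=; first by rewrite flin plin.
  by rewrite qp fpos.
exists (g \o psi); split=> [a x y|x /gneg] /=; first by rewrite slin glin.
by rewrite qs.
Qed.

Section Hermitian.
Variables (n : nat) (A : 'M[C]_n).
Hypothesis Aherm : map_mx Num.conj A^T = A.

Definition mxform (x : 'rV[C]_n) : C := (x *m A *m map_mx Num.conj x^T) 0 0.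

Let P := spectralmx A.
Let d := spectral_diag A.

Lemma herm_spectral : A = invmx P *m diag_mx d *m P.
Proof.
apply/orthomx_spectralP/hermitian_normalmx.
by apply/is_hermitianmxP; rewrite expr0 scale1r Aherm.
Qed.

Lemma spectral_diag_real i : d 0 i \is Num.real.
Proof.
have /hermitian_spectral_diag_real/mxOverP/(_ 0 i) // : A \is hermsymmx.
by apply/is_hermitianmxP; rewrite expr0 scale1r Aherm.
Qed.

Lemma mxform_spectral y : mxform (y *m P) = \sum_i d 0 i * (y 0 i * (y 0 i)^*).
Proof.
have PV : invmx P = map_mx Num.conj P^T by apply: invmx_unitary (spectral_unitarymx A).
rewrite /mxform [in LHS]herm_spectral -!mulmxA trmx_mul map_mxM -PV.
rewrite !mulmxA mulmxK ?spectral_unit // mulmxK ?spectral_unit //.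
rewrite mxE; apply: eq_bigr => i _; rewrite !mxE (bigD1 i) //= !mxE eqxx mulr1n.
rewrite big1 ?addr0; first by ring.
by move=> j ji; rewrite !mxE (negPf ji) mulr0n mulr0.
Qed.

Definition incl (S : {set 'I_n}) : 'M[C]_(#|S|, n) :=
  \matrix_(j, i) (enum_val j == i)%:R.

Lemma incl_out (S : {set 'I_n}) (y : 'rV[C]_#|S|) i : i \notin S -> (y *m incl S) 0 i = 0.
Proof.
move=> iS; rewrite mxE big1 // => j _; rewrite mxE.
by case: eqP (enum_valP j) iS => [-> ->|_ _ _]; rewrite ?mulr0.
Qed.

Lemma inclK (S : {set 'I_n}) (y : 'rV[C]_#|S|) : y *m incl S *m (incl S)^T = y.
Proof.
rewrite -mulmxA [_ *m _^T](_ : _ = 1%:M) ?mulmx1 //; apply/matrixP => j k.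
rewrite !mxE (bigD1 (enum_val j)) //= !mxE eqxx mul1r big1 ?addr0.
  by rewrite (inj_eq enum_val_inj) eq_sym.
by move=> i ij; rewrite !mxE [_ == i]eq_sym (negPf ij) mul0r.
Qed.

Lemma incl_tr (S : {set 'I_n}) (x : 'rV[C]_n) i : i \in S -> x *m (incl S)^T = 0 -> x 0 i = 0.
Proof.
move=> iS /rowP/(_ (enum_rank_in iS i)); rewrite !mxE (bigD1 i) //= !mxE.
rewrite enum_rankK_in // eqxx mulr1 big1 ?addr0 // => j ji.
by rewrite !mxE enum_rankK_in // [_ == j]eq_sym (negPf ji) mulr0.
Qed.

Lemma mxform_incl (S : {set 'I_n}) (y : 'rV[C]_#|S|) :
  mxform (y *m incl S *m P)
  = \sum_(i in S) d 0 i * ((y *m incl S) 0 i * ((y *m incl S) 0 i)^*).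
Proof.
rewrite mxform_spectral [LHS](bigID (mem S)) /= [X in _ + X]big1 ?addr0 //.
by move=> i iS; rewrite incl_out // mul0r mulr0.
Qed.

Lemma incl_neq0 (S : {set 'I_n}) (y : 'rV[C]_#|S|) :
  y != 0 -> exists2 i, i \in S & (y *m incl S) 0 i != 0.
Proof.
move=> y0; apply/exists_inP; apply: contraNT y0; rewrite negb_exists_in.
move=> /forall_inP yS; rewrite -(inclK y); apply/eqP.
rewrite [y *m _](_ : _ = 0) ?mul0mx //.
apply/rowP => i; rewrite [RHS]mxE; case: (boolP (i \in S)) => [/yS|/incl_out->//].
by rewrite negbK => /eqP.
Qed.

Lemma mxform_definite_ge (S : {set 'I_n}) (e : C) : e \is Num.real ->
  (forall i, i \in S -> 0 < e * d 0 i) -> pos_ge (fun x => e * mxform x) #|S|.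
Proof.
move=> er Spos; exists (fun y => y *m incl S *m P); split=> [a x y|y y0].
  by rewrite !mulmxDl !scalemxAl.
rewrite mxform_incl mulr_sumr; have [i iS yi] := incl_neq0 y0.
rewrite (bigD1 i) //= ltr_pwDl //.
  by rewrite mulrA mulr_gt0 ?Spos // mul_conjC_gt0.
apply: sumr_ge0 => j /andP[jS _]; rewrite mulrA mulr_ge0 ?mul_conjC_ge0 //.
by rewrite ltW // Spos.
Qed.

Lemma mxform_definite_le (S : {set 'I_n}) (e : C) : e \is Num.real ->
  (forall i, i \notin S -> e * d 0 i <= 0) -> pos_le (fun x => e * mxform x) #|S|.
Proof.
move=> er Sneg; exists (fun x => x *m invmx P *m (incl S)^T); split=> [a x y|x].
  by rewrite !mulmxDl !scalemxAl.
have xE : x = x *m invmx P *m P by rewrite mulmxKV // spectral_unit.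
move=> x0; rewrite xE mxform_spectral mulr_sumr -oppr_ge0 -sumrN.
apply: sumr_ge0 => i _; rewrite oppr_ge0 mulrA.
case: (boolP (i \in S)) => [iS|/Sneg neg].
  by rewrite (incl_tr iS x0) mul0r mulr0.
by rewrite mulr_le0_ge0 // mul_conjC_ge0.
Qed.

Lemma mxform_has_pos : has_pos mxform #|[set i : 'I_n | 0 < d 0 i]%SET|.
Proof.
have -> : mxform = fun x => 1 * mxform x by apply/funext => x; rewrite mul1r.
split.
  apply: (@mxform_definite_ge [set i : 'I_n | 0 < d 0 i]%SET 1); rewrite ?rpred1 // => i.
  by rewrite inE mul1r.
apply: mxform_definite_le; rewrite ?rpred1 // => i; rewrite inE mul1r.
by rewrite real_ltNge ?spectral_diag_real ?rpred0 // negbK.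
Qed.

Lemma mxform_has_neg : has_pos (fun x => - mxform x) #|[set i : 'I_n | d 0 i < 0]%SET|.
Proof.
have -> : (fun x => - mxform x) = fun x => -1 * mxform x.
  by apply/funext => x; rewrite mulN1r.
split.
  apply: mxform_definite_ge; rewrite ?rpredN ?rpred1 // => i.
  by rewrite inE mulN1r oppr_gt0.
apply: mxform_definite_le; rewrite ?rpredN ?rpred1 // => i.
by rewrite inE mulN1r oppr_le0 real_ltNge ?spectral_diag_real ?rpred0 // negbK.
Qed.

(** The eigenvectors of eigenvalue zero: the indices of a Hermitian form and the
dimension of its radical exhaust the dimension. *)
Lemma mxform_radical : exists r, exists2 f : 'rV[C]_r -> 'rV[C]_n,
  [/\ linear f, forall y, f y *m A = 0 & forall y, f y = 0 -> y = 0] &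
  (#|[set i : 'I_n | (0 < d 0 i)%R]%SET| + #|[set i : 'I_n | (d 0 i < 0)%R]%SET| + r)%N = n.
Proof.
pose S := [set i : 'I_n | d 0 i == 0]%SET; exists #|S|.
exists (fun y => y *m incl S *m P); first split=> [a x y|y|y].
- by rewrite !mulmxDl !scalemxAl.
- rewrite [in LHS]herm_spectral !mulmxA mulmxK ?spectral_unit //.
  rewrite [_ *m diag_mx d](_ : _ = 0) ?mul0mx //; apply/rowP => i.
  rewrite mul_mx_diag !mxE; case: (boolP (i \in S)) => [|iS].
    by rewrite inE => /eqP->; rewrite mulr0.
  by have := incl_out y iS; rewrite mxE => ->; rewrite mul0r.
- move=> /(congr1 (mulmx^~ (invmx P))); rewrite mul0mx mulmxK ?spectral_unit //.
  by move=> /(congr1 (mulmx^~ (incl S)^T)); rewrite mul0mx inclK.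
rewrite -[RHS]card_ord -!sum1_card /= [RHS](bigID (fun i => 0 < d 0 i)) /=.
rewrite -addnA; congr (_ + _)%N; first by apply: eq_bigl => i; rewrite inE.
rewrite [RHS](bigID (fun i => d 0 i < 0)) /=; congr (_ + _)%N; apply: eq_bigl => i;
 rewrite !inE; have /real_ltgt0P := spectral_diag_real i.
  by case=> //; rewrite ?ltxx.
by case=> // h; rewrite ?eqxx ?ltxx.
Qed.

End Hermitian.
End Inertia.

Section HermitianForms.
Variable C : numClosedFieldType.

Definition hermitian_via (V : lmodType C) (q : V -> C) (b : V -> V -> C) :=
  [/\ forall y, linear (b^~ y : V -> C^o), forall x y, b y x = (b x y)^*
    & forall x, q x = b x x].

Definition hermitian (V : lmodType C) (q : V -> C) := exists b, hermitian_via q b.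

(** Twice the real part of the Hermitian product. *)
Definition dot (a b : C) : C := a * b^* + a^* * b.

Lemma hermitianD (V : lmodType C) (q1 q2 : V -> C) :
  hermitian q1 -> hermitian q2 -> hermitian (fun x => q1 x + q2 x).
Proof.
move=> [b1 [lin1 sym1 q1E]] [b2 [lin2 sym2 q2E]].
exists (fun x y => b1 x y + b2 x y); split=> [y a x z|x y|x] /=.
- rewrite lin1 lin2 scalerDr /=; set t1 := a *: _; set t2 := a *: _; ring.
- by rewrite sym1 sym2 rmorphD.
- by rewrite q1E q2E.
Qed.

Lemma hermitianZ (V : lmodType C) (e : C) (q : V -> C) :
  e \is Num.real -> hermitian q -> hermitian (fun x => e * q x).
Proof.
move=> er [b [lin sym qE]]; exists (fun x y => e * b x y); split=> [y a x z|x y|x] /=.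
- by rewrite lin mulrDr /= scalerAr.
- by rewrite sym rmorphM /= (CrealP er).
- by rewrite qE.
Qed.

Lemma hermitian_dot (V : lmodType C) (l1 l2 : V -> C^o) :
  linear l1 -> linear l2 -> hermitian (fun x => dot (l1 x) (l2 x)).
Proof.
move=> lin1 lin2.
exists (fun x y => l1 x * (l2 y)^* + l2 x * (l1 y)^*); split=> [y a x z|x y|x] /=.
- by rewrite lin1 lin2 /= /GRing.scale /=; ring.
- by rewrite rmorphD /= !rmorphM /= !conjCK; ring.
- by rewrite /dot; ring.
Qed.

Lemma hermitian_row (n : nat) (q : 'rV[C]_n -> C) b : hermitian_via q b ->
  exists2 A : 'M[C]_n, map_mx Num.conj A^T = A
    & q = mxform A /\ forall x y, b x y = (x *m A *m map_mx Num.conj y^T) 0 0.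
Proof.
move=> [lin sym qE]; pose e i : 'rV[C]_n := delta_mx 0 i.
have bE x y : b x y = \sum_i x 0 i * b (e i) y.
  pose B : {linear 'rV[C]_n -> C^o} :=
    HB.pack (b^~ y : 'rV[C]_n -> C^o) (GRing.isLinear.Build _ _ _ _ (b^~ y : _ -> C^o) (lin y)).
  rewrite [x in LHS]row_sum_delta -[LHS]/(B _) linear_sum.
  by apply: eq_bigr => i _; rewrite linearZ.
have AE x y : b x y = (x *m (\matrix_(i, j) b (e i) (e j)) *m map_mx Num.conj y^T) 0 0.
  rewrite bE -mulmxA mxE; apply: eq_bigr => i _; congr (_ * _).
  rewrite mxE sym bE rmorph_sum; apply: eq_bigr => j _.
  by rewrite rmorphM /= -sym !mxE mulrC.
exists (\matrix_(i, j) b (e i) (e j)).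
  by apply/matrixP => i j; rewrite !mxE -sym.
by split => //; apply/funext => x; rewrite qE AE.
Qed.

(** Sylvester's law of inertia, with the radical parametrized by [f].  The
radical appears through the additivity of the form, which is the property that
can be tested on paths. *)
Lemma hermitian_inertia (n : nat) (q : 'rV[C]_n -> C) : hermitian q ->
  exists p m r, [/\ has_pos q p, has_pos (fun x => - q x) m, (p + m + r)%N = n
    & exists f : 'rV[C]_r -> 'rV[C]_n, [/\ linear f,
        forall y z, q (f y + z) = q (f y) + q z & forall y, f y = 0 -> y = 0]].
Proof.
move=> [b bP]; have [A Aherm [-> bE]] := hermitian_row bP.
have [lin sym qE] := bP.
have [r [f [flin f0 finj] cards]] := mxform_radical Aherm.
eexists; eexists; exists r; split; [exact: mxform_has_pos|exact: mxform_has_neg|exact: cards|].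
exists f; split=> // y z; rewrite /mxform !mulmxDl f0 mul0mx !add0r.
rewrite linearD /= map_mxD mulmxDr mul0mx [X in _ = X + _]mxE add0r.
rewrite mxE [X in X + _](_ : _ = 0) ?add0r // -bE sym bE f0 mul0mx mxE.
exact: rmorph0.
Qed.

End HermitianForms.

(** * The Hermitian form of a path *)

Section PathForm.
Variable C : numClosedFieldType.
Local Notation stream := (nat -> C^o).

Definition sgn (b : bool) : C := if b then 1 else -1.

Definition stail (m : nat) (x : stream) : stream := fun k => x (m + k)%N.

Fixpoint disp (i : 'I_2) (w : word) (x : stream) : C :=
  if w is c :: w' then (if c.1 == i then x 0%N else 0) + disp i w' (stail 1 x)
  else 0.

(** The form evaluated on the path whose steps are the successive entries of
[x], from the base point [(u, v)]: a step of column 0 pairs with the current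
second coordinate, a step of column 1 with the current first one, so that the
mixed terms add up to the area swept from the origin. *)
Fixpoint path_form (w : word) (u v : C) (x : stream) : C :=
  if w is c :: w' then
    - sgn c.2 * dot (x 0%N) (x 0%N) +
    (if c.1 == ord0 then - dot (x 0%N) v + path_form w' (u + x 0%N) v (stail 1 x)
     else dot (x 0%N) u + path_form w' u (v + x 0%N) (stail 1 x))
  else 0.

Lemma ordP (i : 'I_2) : i = ord0 \/ i = ord_max.
Proof. by case: i => -[|[|//]] ?; [left|right]; apply: val_inj. Qed.

Lemma dotDl a b c : dot (a + b) c = dot a c + dot b c :> C.
Proof. by rewrite /dot rmorphD /=; ring. Qed.

Lemma dotDr a b c : dot a (b + c) = dot a b + dot a c :> C.
Proof. by rewrite /dot rmorphD /=; ring. Qed.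

Lemma dotNl a b : dot (- a) b = - dot a b :> C.
Proof. by rewrite /dot rmorphN /=; ring. Qed.

Lemma dotNr a b : dot a (- b) = - dot a b :> C.
Proof. by rewrite /dot rmorphN /=; ring. Qed.

Lemma dotC a b : dot a b = dot b a :> C.
Proof. by rewrite /dot; ring. Qed.

Lemma dot0l a : dot 0 a = 0 :> C.
Proof. by rewrite /dot rmorph0; ring. Qed.

Lemma dot0r a : dot a 0 = 0 :> C.
Proof. by rewrite dotC dot0l. Qed.

Lemma dotxx a : dot a a = 2 * (a * a^*) :> C.
Proof. by rewrite /dot; ring. Qed.

Lemma dotxx_ge0 a : 0 <= dot a a :> C.
Proof. by rewrite dotxx mulr_ge0 // mul_conjC_ge0. Qed.

Lemma dotxx_eq0 a : (dot a a == 0 :> C) = (a == 0).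
Proof. by rewrite dotxx mulf_eq0 pnatr_eq0 /= mul_conjC_eq0. Qed.

(** Moving the base point changes the form by the pairing of the translation
with the total displacement; the form of a closed path is translation
invariant. *)
Lemma path_form_shift w u v a b x :
  path_form w (u + a) (v + b) x
  = path_form w u v x + dot (disp ord_max w x) a - dot (disp ord0 w x) b.
Proof.
elim: w u v x => [|c w IH] u v x /=; first by rewrite !dot0l subr0 addr0.
have [->|->] := ordP c.1; rewrite /= ?add0r !(dotDl, dotDr).
  by rewrite [u + a + _]addrAC IH; ring.
by rewrite [v + b + _]addrAC IH; ring.
Qed.

Lemma stail_add m n x : stail m (stail n x) = stail (n + m) x.
Proof. by apply/funext => k; rewrite /stail addnA. Qed.

Lemma disp_cat i p w x : disp i (p ++ w) x = disp i p x + disp i w (stail (size p) x).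
Proof.
elim: p x => [|c p IH] x /=; first by rewrite add0r.
by rewrite IH stail_add addrA.
Qed.

Lemma path_form_cat p w u v x :
  path_form (p ++ w) u v x = path_form p u v x
  + path_form w (u + disp ord0 p x) (v + disp ord_max p x) (stail (size p) x).
Proof.
elim: p u v x => [|c p IH] u v x /=; first by rewrite !addr0 add0r.
have [->|->] := ordP c.1; rewrite /= IH stail_add add0r !addrA.
  by congr (_ + path_form _ _ _ _).
by congr (_ + path_form _ _ _ _).
Qed.

Lemma disp_eq i w x y : (forall k, (k < size w)%N -> x k = y k) ->
  disp i w x = disp i w y.
Proof.
elim: w x y => [//|c w IH] x y xy /=; rewrite xy // (IH _ (stail 1 y)) // => k kw.
by apply: xy; rewrite ltnS.
Qed.

Lemma path_form_eq w u v x y : (forall k, (k < size w)%N -> x k = y k) ->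
  path_form w u v x = path_form w u v y.
Proof.
elim: w u v x y => [//|c w IH] u v x y xy /=; rewrite xy //.
have IH' u' v' : path_form w u' v' (stail 1 x) = path_form w u' v' (stail 1 y).
  by apply: IH => k kw; apply: xy; rewrite ltnS.
by rewrite !IH'.
Qed.

Lemma linear_stail (V : lmodType C) m (l : V -> stream) :
  linear l -> linear (fun x => stail m (l x)).
Proof. by move=> llin a x y; apply/funext => k; rewrite /stail llin. Qed.

Lemma linear_coord (V : lmodType C) k (l : V -> stream) :
  linear l -> linear (fun x => l x k).
Proof. by move=> llin a x y; rewrite llin. Qed.

Lemma linearDf (V : lmodType C) (l1 l2 : V -> C^o) :
  linear l1 -> linear l2 -> linear (fun x => l1 x + l2 x : C^o).
Proof. by move=> h1 h2 a x y; rewrite h1 h2 scalerDr addrACA. Qed.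

Lemma linear_disp (V : lmodType C) i w (l : V -> stream) :
  linear l -> linear (fun x => disp i w (l x) : C^o).
Proof.
elim: w l => [|c w IH] l llin /=; first by move=> a x y; rewrite scaler0 addr0.
apply: linearDf; last exact/IH/linear_stail.
case: eqP => _; first exact: linear_coord.
by move=> a x y; rewrite scaler0 addr0.
Qed.

Lemma hermitian_path_form (V : lmodType C) w (lu lv : V -> C^o) (l : V -> stream) :
  linear lu -> linear lv -> linear l ->
  hermitian (fun x => path_form w (lu x) (lv x) (l x)).
Proof.
elim: w lu lv l => [|c w IH] lu lv l ulin vlin llin /=.
  by exists (fun _ _ => 0); split=> [y a x z|x y|//]; rewrite ?scaler0 ?addr0 ?rmorph0.
have l0 := linear_coord 0 llin; have l1 := linear_stail 1 llin.
apply: hermitianD.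
  apply: hermitianZ; last exact: hermitian_dot.
  by rewrite /sgn; case: c.2; rewrite rpredN ?rpredN rpred1.
have [->|->] := ordP c.1; rewrite /=; apply: hermitianD; try exact: hermitian_dot.
- under eq_fun do rewrite -mulN1r.
  by apply: hermitianZ; [rewrite rpredN rpred1|exact: hermitian_dot].
- by apply: IH => //; exact: linearDf.
- by apply: IH => //; exact: linearDf.
Qed.

(** The entries 0 and 1 are the base point.  Streams, rather than vectors of
the right size, make the space independent of the word. *)
Definition braid_form (w : word) (x : stream) : C :=
  path_form w (x 0%N) (x 1%N) (stail 2 x).

Definition spad n (y : 'rV[C]_n) : stream :=
  fun k => if insub k is Some i then y 0 i else 0.

Definition strunc n (x : stream) : 'rV[C]_n := \row_i x i.

Lemma linear_spad n : linear (@spad n).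
Proof.
move=> a x y; apply/funext => k; rewrite -[RHS]/((a * spad x k + spad y k : C)) /spad.
by case: insubP => [i _ _|_]; rewrite ?mxE // mulr0 addr0.
Qed.

Lemma linear_strunc n : linear (@strunc n).
Proof. by move=> a x y; apply/rowP => i; rewrite !mxE. Qed.

Lemma spadE n (y : 'rV[C]_n) (i : 'I_n) : spad y i = y 0 i.
Proof. by rewrite /spad valK. Qed.

Lemma spad_strunc n x k : (k < n)%N -> spad (strunc n x) k = x k.
Proof. by move=> kn; rewrite /spad insubT mxE. Qed.

Lemma braid_form_pad w x : braid_form w (spad (strunc (size w).+2 x)) = braid_form w x.
Proof.
rewrite /braid_form !spad_strunc //; apply: path_form_eq => k kw.
by rewrite /stail spad_strunc.
Qed.

(** The form is nondegenerate on closed paths, up to the closing conditions: testing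
additivity against a multiple of the first step shows that this step vanishes,
and one proceeds with the rest of the path. *)
Lemma path_form_radical w x :
  disp ord0 w x = 0 -> disp ord_max w x = 0 ->
  (forall z, path_form w 0 0 (fun k => x k + z k)
    = path_form w 0 0 x + path_form w 0 0 z) ->
  forall k, (k < size w)%N -> x k = 0.
Proof.
elim: w x => [//|c w IH] x /= dx0 dy0 rad.
have p0 u v : path_form w u v (fun=> 0) = 0.
  elim: {+}w u v => //= c' w' IH' u v; rewrite /stail !IH' !dot0l.
  by case: ifP => _; ring.
have x0 : x 0%N = 0.
  have := rad (fun k => if k is 0%N then x 0%N else 0); rewrite /stail /=.
  have -> : (fun k => x (1 + k)%N + (if (1 + k)%N is 0%N then x 0%N else 0))
      = stail 1 x by apply/funext => k; rewrite addr0.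
  have tr : (fun k => x (1 + k)%N) = stail 1 x by [].
  have e2 : sgn c.2 * sgn c.2 = 1 by rewrite /sgn; case: c.2; rewrite ?mulrNN mulr1.
  (* A form that is additive between [t] and itself vanishes on [t]: the
     quadratic part gets multiplied by four on one side, by two on the other. *)
  have quad (t p : C) : - sgn c.2 * (t + t + (t + t)) + p
      = - sgn c.2 * t + p + - sgn c.2 * t -> t = 0.
    move=> h; have : sgn c.2 * (t + t) = 0.
      have -> : sgn c.2 * (t + t) = - sgn c.2 * t + p + - sgn c.2 * t
        - (- sgn c.2 * (t + t + (t + t)) + p) by ring.
      by rewrite h subrr.
    move=> /(congr1 (fun z => sgn c.2 * z)); rewrite mulr0 mulrA e2 mul1r => /eqP.
    by rewrite -mulr2n mulrn_eq0 /= => /eqP.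
  rewrite tr !p0 !dot0r; move: dx0 dy0; have [->|->] := ordP c.1 => /=.
    rewrite add0r => dx0 dy0; rewrite oppr0 !add0r addr0.
    have -> : path_form w (x 0%N + x 0%N) 0 (stail 1 x)
        = path_form w (x 0%N) 0 (stail 1 x).
      rewrite -[X in path_form w _ X _ = _](addr0 (0 : C)) path_form_shift dy0.
      by rewrite !(dot0l, dot0r) subr0 addr0.
    rewrite !(dotDl, dotDr) => /quad/eqP.
    by rewrite dotxx_eq0 => /eqP.
  rewrite add0r => dx0 dy0; rewrite !add0r addr0.
  have -> : path_form w 0 (x 0%N + x 0%N) (stail 1 x)
      = path_form w 0 (x 0%N) (stail 1 x).
    rewrite -[X in path_form w X _ _ = _](addr0 (0 : C)) path_form_shift dx0.
    by rewrite !(dot0l, dot0r) subr0 addr0.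
  rewrite !(dotDl, dotDr) => /quad/eqP.
  by rewrite dotxx_eq0 => /eqP.
case=> [//|k]; rewrite ltnS => kw; apply: (IH (stail 1 x)) => //.
- by move: dx0; rewrite x0 if_same add0r.
- by move: dy0; rewrite x0 if_same add0r.
move=> z; have := rad (fun k => if k is k'.+1 then z k' else 0).
rewrite /= x0 !addr0 !dot0l oppr0 !mulr0 !add0r.
by case: ifP => _ h; exact: h.
Qed.

End PathForm.

(** * The signature of a word *)

Section WordInertia.
Variable C : numClosedFieldType.
Local Notation stream := (nat -> C^o).

Lemma linear_idfun (V : lmodType C) : linear (fun x : V => x).
Proof. by []. Qed.

Lemma linear_row (V : lmodType C) m (l : 'I_m -> V -> C^o) :
  (forall i, linear (l i)) -> linear (fun x => \row_i l i x : 'rV[C]_m).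
Proof. by move=> llin a x y; apply/rowP => i; rewrite !mxE llin. Qed.

(** The space has dimension [size w + 2], and the radical has dimension at most
four: it is cut to zero by the base point and the two total displacements,
according to [path_form_radical]. *)
Lemma word_inertia (w : word) : exists pm : nat * nat,
  [/\ has_pos (@braid_form C w) pm.1, has_pos (fun x => - @braid_form C w x) pm.2
    & (size w <= pm.1 + pm.2 + 2)%N].
Proof.
pose n := (size w).+2; have plin := @linear_spad C n.
have hq : hermitian (fun y : 'rV[C]_n => braid_form w (spad y)).
  apply: hermitian_path_form; try exact: linear_coord.
  exact: linear_stail.
have [p [m [r [hp hm cards [f [flin frad finj]]]]]] := hermitian_inertia hq.
exists (p, m); split=> /=.
- apply: (has_pos_isometry (@linear_spad C n) (@linear_strunc C n) _ _ hp) => //.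
  exact: braid_form_pad.
- apply: (has_pos_isometry (@linear_spad C n) (@linear_strunc C n) _ _ hm) => //.
  by move=> y; rewrite braid_form_pad.
suff r4 : (r <= 4)%N by lia.
rewrite leqNgt; apply/negP => r4.
have flin' : linear (fun y => spad (f y)) by move=> a x y; rewrite flin plin.
(* the base point and the two total displacements *)
pose h (y : 'rV[C]_r) : 'rV[C]_4 := \row_(i < 4)
  nth (0 : C^o) [:: spad (f y) 0%N; spad (f y) 1%N; disp ord0 w (stail 2 (spad (f y)));
            disp ord_max w (stail 2 (spad (f y)))] i.
have hlin : linear h.
  apply: linear_row => -[[|[|[|[|//]]]] ?] /=.
  - exact: (linear_coord 0 flin').
  - exact: (linear_coord 1 flin').
  - exact: (linear_disp ord0 w (linear_stail 2 flin')).
  - exact: (linear_disp ord_max w (linear_stail 2 flin')).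
have [y y0 /rowP hy] := linear_kernel hlin r4.
have := hy 0; have := hy 1; have := hy (inord 2); have := hy (inord 3).
rewrite !mxE !inordK //= => d1 d0 v0 u0.
case/eqP: y0; apply: finj; apply/rowP => i; rewrite mxE -spadE.
have steps0 : forall k, (k < size w)%N -> stail 2 (spad (f y)) k = 0.
  apply: path_form_radical => // z.
  pose z' k : C := if k is k'.+2 then z k' else 0.
  have sE k : (k < n)%N -> spad (f y + strunc n z') k = spad (f y) k + z' k.
    by move=> kn; rewrite -[k]/(nat_of_ord (Ordinal kn)) !spadE !mxE.
  have := frad y (strunc n z'); rewrite braid_form_pad /braid_form !sE // u0 v0.
  rewrite !addr0 => <-; apply: path_form_eq => k kw.
  by rewrite [RHS]sE // /n; lia.
case: i => -[|[|k]] kn //=; rewrite ?u0 ?v0 //.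
exact: steps0.
Qed.

Definition npos w := (sval (cid (word_inertia w))).1.
Definition nneg w := (sval (cid (word_inertia w))).2.
Definition sig w : int := (npos w)%:Z - (nneg w)%:Z.

Lemma npos_has w : has_pos (@braid_form C w) (npos w).
Proof. by rewrite /npos; case: cid => pm [? ? ?]. Qed.

Lemma nneg_has w : has_pos (fun x => - @braid_form C w x) (nneg w).
Proof. by rewrite /nneg; case: cid => pm [? ? ?]. Qed.

Lemma nullity w : (size w <= npos w + nneg w + 2)%N.
Proof. by rewrite /npos /nneg; case: cid => pm [? ? ?]. Qed.

Lemma braid_form0 w : @braid_form C w 0 = 0.
Proof.
rewrite /braid_form /=; have -> : stail 2 (0 : stream) = (fun=> 0) by [].
have -> k : (0 : stream) k = 0 by []. 
have p0 : forall u v : C, path_form w u v (fun=> 0) = 0.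
  elim: w => //= c w' IH u v; rewrite /stail !IH !dot0l.
  by case: ifP => _; ring.
exact: p0.
Qed.

(** The form in which [pos_comparison] is applied: forms that coincide under
[phi] on the kernel of [m] functionals have indices that differ by at most
[m]. *)
Lemma index_le (V1 V2 : lmodType C) (q1 : V1 -> C) (q2 : V2 -> C) (phi : V1 -> V2)
    m (l : 'I_m -> V1 -> C^o) p1 n1 p2 n2 :
  linear phi -> (forall i, linear (l i)) ->
  (forall x, (forall i, l i x = 0) -> q1 x = q2 (phi x)) ->
  has_pos q1 p1 -> has_pos (fun x => - q1 x) n1 ->
  has_pos q2 p2 -> has_pos (fun x => - q2 x) n2 ->
  (p1 <= p2 + m)%N /\ (n1 <= n2 + m)%N.
Proof.
move=> plin llin q12 hp1 hn1 hp2 hn2.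
have l0 x : \row_i l i x = 0 -> forall i, l i x = 0.
  by move=> /rowP h i; move: (h i); rewrite !mxE.
split.
  apply: (pos_comparison plin (linear_row llin) _ hp1 hp2) => x /l0 lx.
  by rewrite q12.
apply: (pos_comparison plin (linear_row llin) _ hn1 hn2) => x /l0 lx.
by rewrite q12.
Qed.

Lemma stream_lin a (x y : stream) k : (a *: x + y) k = a * x k + y k.
Proof. by []. Qed.

Lemma disp_stail_lin i w m a (x y : stream) : disp i w (stail m (a *: x + y))
  = a * disp i w (stail m x) + disp i w (stail m y).
Proof.
exact: (linear_disp i w (linear_stail m (@linear_idfun stream))).
Qed.

Lemma inertia_cat_le u v :
  (npos (u ++ v) <= npos u + npos v)%N /\ (nneg (u ++ v) <= nneg u + nneg v)%N.
Proof.
pose phi (x : stream) : (stream * stream)%type := (x, fun k =>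
  if k is k'.+2 then stail (size u).+2 x k'
  else if k is 1%N then x 1%N + disp ord_max u (stail 2 x)
  else x 0%N + disp ord0 u (stail 2 x)).
have plin : linear phi.
  move=> a x y; congr pair; apply/funext => -[|[|k]] //.
    rewrite -[RHS]/(a * (phi x).2 0%N + (phi y).2 0%N) /phi /=.
    by rewrite disp_stail_lin stream_lin; ring.
  rewrite -[RHS]/(a * (phi x).2 1%N + (phi y).2 1%N) /phi /=.
  by rewrite disp_stail_lin stream_lin; ring.
rewrite -[X in (_ <= X)%N /\ _]addn0 -[X in _ /\ (_ <= X)%N]addn0.
apply: (@index_le _ _ (@braid_form C (u ++ v))
  (fun x : (stream * stream)%type => braid_form u x.1 + braid_form v x.2)
  phi 0 (fun _ _ => 0)).
- exact: plin.
- by case.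
- by move=> x _; rewrite /braid_form path_form_cat stail_add.
- exact: npos_has.
- exact: nneg_has.
- by apply: has_pos_sum (npos_has u) (npos_has v); exact: braid_form0.
- under eq_fun do rewrite opprD.
  apply: (has_pos_sum (q1 := fun x => - braid_form u x)
    (q2 := fun x => - braid_form v x) _ _ (nneg_has u) (nneg_has v));
  by rewrite braid_form0 oppr0.
Qed.

Lemma inertia_cat_ge u v :
  (npos u + npos v <= npos (u ++ v) + 2)%N /\ (nneg u + nneg v <= nneg (u ++ v) + 2)%N.
Proof.
pose phi (x : (stream * stream)%type) : stream := fun k =>
  if (k < (size u).+2)%N then x.1 k else x.2 (k - size u)%N.
pose l (i : 'I_2) (x : (stream * stream)%type) : C^o :=
  x.2 i - (x.1 i + disp i u (stail 2 x.1)).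
apply: (@index_le _ _ (fun x : (stream * stream)%type => braid_form u x.1 + braid_form v x.2)
   (@braid_form C (u ++ v)) phi 2 l).
- move=> a x y; apply/funext => k; rewrite -[RHS]/(a * phi x k + phi y k) /phi.
  by case: ifP.
- move=> i a x y; rewrite /l /=.
  by rewrite disp_stail_lin !stream_lin /GRing.scale /=; ring.
- move=> x lx; rewrite {3}/braid_form path_form_cat stail_add.
  have uE k : (k < (size u).+2)%N -> phi x k = x.1 k by rewrite /phi => ->.
  have stE : forall k, (k < size u)%N -> stail 2 (phi x) k = stail 2 x.1 k.
    by move=> k ku; rewrite /stail uE.
  rewrite !uE // (path_form_eq _ _ stE) !(disp_eq _ stE); congr (_ + _).
  have vE (i : 'I_2) : x.1 i + disp i u (stail 2 x.1) = x.2 i.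
    by apply/esym/eqP; rewrite -subr_eq0; apply/eqP; exact: lx.
  rewrite (vE ord0) (vE ord_max) /braid_form; apply: path_form_eq => k _.
  by rewrite /stail /phi ltnNge ifF; [congr (x.2 _); lia|apply/negbTE; rewrite negbK; lia].
- by apply: has_pos_sum (npos_has u) (npos_has v); exact: braid_form0.
- under eq_fun do rewrite opprD.
  apply: (has_pos_sum (q1 := fun x => - braid_form u x)
    (q2 := fun x => - braid_form v x) _ _ (nneg_has u) (nneg_has v));
  by rewrite braid_form0 oppr0.
- exact: npos_has.
- exact: nneg_has.
Qed.

(** A path for [u ++ v] is a path for [u] together with a path for [v] that
starts where the first one ends.  The two conditions of matching are the only
loss. *)
Lemma sig_cat u v : `|sig (u ++ v) - sig u - sig v| <= 2.
Proof.
have := inertia_cat_le u v; have := inertia_cat_ge u v; rewrite /sig.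
by case=> ? ? [? ?]; lia.
Qed.

Definition endpoint (i : 'I_2) (p : word) (x : stream) : C :=
  x i + disp i p (stail 2 x).

Lemma endpoint_lin i p a (x y : stream) :
  endpoint i p (a *: x + y) = a * endpoint i p x + endpoint i p y.
Proof. by rewrite /endpoint disp_stail_lin stream_lin; ring. Qed.

Lemma endpoint_eq i p (x y : stream) : (forall k, (k < (size p).+2)%N -> x k = y k) ->
  endpoint i p x = endpoint i p y.
Proof.
move=> xy; rewrite /endpoint xy; last by have := ltn_ord i; lia.
by congr (_ + _); apply: disp_eq => k kp; apply: xy; lia.
Qed.

Lemma braid_form_cat3 p u s (x : stream) :
  let U := endpoint ord0 p x in let V := endpoint ord_max p x in
  let y := stail (size p).+2 x in
  braid_form (p ++ u ++ s) x = braid_form p x + path_form u U V y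
    + path_form s (U + disp ord0 u y) (V + disp ord_max u y) (stail (size u) y).
Proof. by rewrite /braid_form !path_form_cat stail_add addrA. Qed.

Lemma braid_form_eq p (x y : stream) : (forall k, (k < (size p).+2)%N -> x k = y k) ->
  braid_form p x = braid_form p y.
Proof.
by move=> xy; rewrite /braid_form !xy //; apply: path_form_eq => k kp; apply: xy; lia.
Qed.

(** Two linear maps in opposite directions that preserve the forms are enough;
they need not be inverse to each other. *)
Lemma sig_isometry w w' (phi psi : stream -> stream) :
  linear phi -> linear psi ->
  (forall x : stream, braid_form w x = braid_form w' (phi x)) ->
  (forall x : stream, braid_form w' x = braid_form w (psi x)) -> sig w = sig w'.
Proof.
move=> plin slin pE sE.
have [p1 n1] := @index_le _ _ _ _ phi 0 (fun _ _ => 0) _ _ _ _ plin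
  (fun i => ltac:(by case: i)) (fun x _ => pE x)
  (npos_has w) (nneg_has w) (npos_has w') (nneg_has w').
have [p2 n2] := @index_le _ _ _ _ psi 0 (fun _ _ => 0) _ _ _ _ slin
  (fun i => ltac:(by case: i)) (fun x _ => sE x)
  (npos_has w') (nneg_has w') (npos_has w) (nneg_has w).
by rewrite /sig; congr (_%:Z - _%:Z); lia.
Qed.

(** Replaces the steps of the three letters that start at index [t] by linear
functions of these steps, and keeps the rest of the path. *)
Definition splice (t : nat) (r : nat -> stream -> C) (x : stream) : stream :=
  fun k => if (k < t)%N then x k else if (k < t + 3)%N then r (k - t)%N (stail t x)
  else x k.

Lemma linear_splice t r :
  (forall k a (x y : stream), r k (a *: x + y) = a * r k x + r k y) ->
  linear (splice t r).
Proof.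
move=> rlin a x y; apply/funext => k.
rewrite -[RHS]/(a * splice t r x k + splice t r y k) /splice.
by case: ifP => // _; case: ifP => // _; exact: rlin.
Qed.

Lemma braid_form_splice p (u v : word) s r : size u = 3%N -> size v = 3%N ->
  (forall i (y y' : stream), (forall k, (k < 3)%N -> y' k = r k y) -> disp i v y' = disp i u y) ->
  (forall U V (y y' : stream), (forall k, (k < 3)%N -> y' k = r k y) ->
     path_form v U V y' = path_form u U V y) ->
  forall x : stream, braid_form (p ++ u ++ s) x
    = braid_form (p ++ v ++ s) (splice (size p).+2 r x).
Proof.
move=> su sv dE fE x; rewrite !braid_form_cat3 su sv.
set t := (size p).+2; set x' := splice t r x.
have lo k : (k < t)%N -> x' k = x k by rewrite /x' /splice => ->.
have mid : forall k, (k < 3)%N -> stail t x' k = r k (stail t x).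
  by move=> k k3; rewrite /x' /stail /splice ltnNge leq_addr /= ltn_add2l k3 addKn.
have hi : stail 3 (stail t x') = stail 3 (stail t x).
  apply/funext => k; rewrite /x' /stail /splice ltnNge leq_addr /=.
  by rewrite ltn_add2l ltnNge leq_addr.
rewrite hi (braid_form_eq lo) !(endpoint_eq _ lo) !(fE _ _ (stail t x)) //.
by rewrite !(dE _ (stail t x)).
Qed.

(** Both sides of the braid relation draw the two sides of a hexagon with given
endpoints and one free parameter; [slide1] and [slide2] match the parameters so
that the two forms agree. *)
Definition slide1 k (y : stream) : C :=
  if k is 0%N then - y 2%N else if k is 1%N then y 0%N + y 2%N else y 1%N + y 2%N.
Definition slide2 k (y : stream) : C :=
  if k is 0%N then y 0%N + y 1%N else if k is 1%N then y 2%N + y 0%N else - y 0%N.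

Lemma sig_braid_relation p s : sig (p ++ [:: s1; s2; s1] ++ s) = sig (p ++ [:: s2; s1; s2] ++ s).
Proof.
apply: (@sig_isometry _ _ (splice (size p).+2 slide1) (splice (size p).+2 slide2)).
- by apply: linear_splice => -[|[|k]] a x y /=; rewrite !stream_lin; ring.
- by apply: linear_splice => -[|[|k]] a x y /=; rewrite !stream_lin; ring.
- apply: braid_form_splice => //.
    move=> i y y' yE; rewrite /= /stail /= !yE //=.
    by have [->|->] := ordP i; rewrite /=; ring.
  move=> U V y y' yE; rewrite /= /stail /= !yE //= /dot !(rmorphD, rmorphN) /=.
  by ring.
- apply: braid_form_splice => //.
    move=> i y y' yE; rewrite /= /stail /= !yE //=.
    by have [->|->] := ordP i; rewrite /=; ring.
  move=> U V y y' yE; rewrite /= /stail /= !yE //= /dot !(rmorphD, rmorphN) /=.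
  by ring.
Qed.

Section Cancel.
Variables (p s : word) (i : 'I_2) (b : bool).
Let pair : word := [:: (i, b); (i, ~~ b)].
Let t := (size p).+2.

Definition unsplice (x : stream) : stream := fun k => if (k < t)%N then x k else x k.+2.

(** A cancelling pair contributes its total step paired with a free linear
combination of its entries: a hyperbolic plane, once the coordinates are
straightened. *)
Lemma braid_form_pair (x : stream) :
  braid_form (p ++ pair ++ s) x = braid_form (p ++ s) (unsplice x)
  + dot (sgn C b * (x t.+1 - x t) + (if i == ord0 then disp ord_max s (stail t (unsplice x))
     - endpoint ord_max p x else endpoint ord0 p x - disp ord0 s (stail t (unsplice x))))
   (x t + x t.+1).
Proof.
have lo k : (k < t)%N -> unsplice x k = x k by rewrite /unsplice => ->.
have hi : stail 2 (stail t x) = stail t (unsplice x).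
  by apply/funext => k; rewrite /stail /unsplice ltnNge leq_addr /= !addnS.
rewrite braid_form_cat3 -[p ++ s]/(p ++ [::] ++ s) braid_form_cat3 -/t.
rewrite (braid_form_eq lo) !(endpoint_eq _ lo) hi /= !addr0.
set z := stail t (unsplice x).
move: (endpoint ord0 p x) (endpoint ord_max p x) => U V.
rewrite /stail addn0 addn1; move: (x t) (x t.+1) => A B.
have e2 : sgn C (~~ b) = - sgn C b by rewrite /sgn; case: b => //=; rewrite opprK.
have [->|->] := ordP i; rewrite /= !add0r !addr0 e2.
  have -> : path_form s (U + (A + B)) V z
      = path_form s U V z + dot (disp ord_max s z) (A + B).
    by rewrite -{1}(addr0 V) path_form_shift dot0r subr0.
  rewrite -[fun k => z (0 + k)%N]/z !(dotDl, dotDr, dotNl, dotNr).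
  rewrite /sgn; case: b; rewrite ?mul1r ?mulN1r !(dotDl, dotNl, opprK) [dot B A]dotC.
    by rewrite (dotC V A) (dotC V B); ring.
  by rewrite (dotC V A) (dotC V B); ring.
have -> : path_form s U (V + (A + B)) z
    = path_form s U V z - dot (disp ord0 s z) (A + B).
  by rewrite -{1}(addr0 U) path_form_shift dot0r addr0.
rewrite -[fun k => z (0 + k)%N]/z !(dotDl, dotDr, dotNl, dotNr).
rewrite /sgn; case: b; rewrite ?mul1r ?mulN1r !(dotDl, dotNl, opprK) [dot B A]dotC.
  by rewrite (dotC U A) (dotC U B); ring.
by rewrite (dotC U A) (dotC U B); ring.
Qed.

Definition pairing (x : stream) : C :=
  if i == ord0 then disp ord_max s (stail t x) - endpoint ord_max p x
  else endpoint ord0 p x - disp ord0 s (stail t x).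

Lemma pairing_lin a (x y : stream) : pairing (a *: x + y) = a * pairing x + pairing y.
Proof.
by rewrite /pairing !endpoint_lin !disp_stail_lin; case: ifP => _; ring.
Qed.

(** A path for [p ++ pair ++ s] in which the contribution of the pair is [e] times
the squared modulus of its total step. *)
Definition hyperbolic (e : C) (xa : (stream * C^o)%type) : stream :=
  let T := sgn C b * (e * (xa.2 / 2) - pairing xa.1) in
  fun k => if (k < t)%N then xa.1 k else if k == t then (xa.2 - T) / 2
  else if k == t.+1 then (xa.2 + T) / 2 else xa.1 k.-2.

Lemma braid_form_hyperbolic e xa :
  e * e = 1 -> e \is Num.real ->
  braid_form (p ++ pair ++ s) (hyperbolic e xa)
  = braid_form (p ++ s) xa.1 + e * (xa.2 * (xa.2)^*).
Proof.
move=> e2 er; rewrite braid_form_pair; set x := hyperbolic e xa.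
have n2 : (2 : C) != 0 by rewrite pnatr_eq0.
have ux k : unsplice x k = xa.1 k.
  rewrite /unsplice /x /hyperbolic; case: ltnP => kt //.
  rewrite ltnNge (leq_trans kt) ?leqW // ifF; last by apply/negbTE; lia.
  by rewrite ifF; last by apply/negbTE; lia.
have xt : x t = (xa.2 - sgn C b * (e * (xa.2 / 2) - pairing xa.1)) / 2.
  by rewrite /x /hyperbolic ltnn eqxx.
have xt1 : x t.+1 = (xa.2 + sgn C b * (e * (xa.2 / 2) - pairing xa.1)) / 2.
  by rewrite /x /hyperbolic ltnNge leqW //= eqxx ifF //; apply/negbTE; lia.
have -> : unsplice x = xa.1 by apply/funext.
have lo k : (k < t)%N -> x k = xa.1 k by rewrite /x /hyperbolic => ->.
rewrite !(endpoint_eq _ lo).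
rewrite -[if _ then _ else _]/(pairing xa.1); congr (_ + _).
have -> : x t + x t.+1 = xa.2 by rewrite xt xt1; field.
have -> : sgn C b * (x t.+1 - x t) = e * (xa.2 / 2) - pairing xa.1.
  have s2 : sgn C b * sgn C b = 1 by rewrite /sgn; case: b; rewrite ?mulrNN mulr1.
  rewrite xt xt1; transitivity ((sgn C b * sgn C b) * (e * (xa.2 / 2) - pairing xa.1)).
    by field.
  by rewrite s2 mul1r.
rewrite addrNK /dot !rmorphM /= (CrealP er) fmorphV rmorph_nat.
by field.
Qed.

Lemma linear_hyperbolic e : linear (hyperbolic e).
Proof.
move=> a x y; apply/funext => k.
rewrite -[RHS]/(a * hyperbolic e x k + hyperbolic e y k) /hyperbolic.
case: ifP => // _; case: ifP => _.
  by rewrite -[(a *: x + y).1]/(a *: x.1 + y.1) pairing_lin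
    -[(a *: x + y).2]/(a * x.2 + y.2); ring.
case: ifP => // _.
by rewrite -[(a *: x + y).1]/(a *: x.1 + y.1) pairing_lin
    -[(a *: x + y).2]/(a * x.2 + y.2); ring.
Qed.

Lemma linear_unsplice : linear unsplice.
Proof.
move=> a x y; apply/funext => k.
rewrite -[RHS]/(a * unsplice x k + unsplice y k) /unsplice.
by case: ifP.
Qed.

(** Dropping the pair costs at most one in each index, and the hyperbolic plane
contributes exactly one to each. *)
Lemma sig_cancel : sig (p ++ pair ++ s) = sig (p ++ s).
Proof.
have [] := @index_le _ _ _ _ unsplice 1 (fun _ x => x t + x t.+1) _ _ _ _
  linear_unsplice _ _ (npos_has (p ++ pair ++ s)) (nneg_has (p ++ pair ++ s))
  (npos_has (p ++ s)) (nneg_has (p ++ s)).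
- by move=> _ a x y; rewrite !stream_lin /GRing.scale /=; ring.
- by move=> x /(_ ord0) h; rewrite braid_form_pair h dot0r addr0.
move=> le1 le2.
pose sq (a : C^o) : C := a * a^*; have sq0 : sq 0 = 0 by rewrite /sq mul0r.
have h1 := has_pos_sum (q2 := sq) (braid_form0 _) sq0 (npos_has (p ++ s)) (@has_pos_norm C).
have h2 := has_pos_sum (q1 := fun x => - braid_form (p ++ s) x) (q2 := sq) _ sq0
  (nneg_has (p ++ s)) (@has_pos_norm C).
have := pos_comparison (phi := hyperbolic 1) (g0 := fun=> 0 : 'rV_0) (linear_hyperbolic 1) _ _
  h1 (npos_has (p ++ pair ++ s)).
have := pos_comparison (phi := hyperbolic (-1)) (g0 := fun=> 0 : 'rV_0)
  (linear_hyperbolic (-1)) _ _ (h2 _) (nneg_has (p ++ pair ++ s)).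
rewrite !addn0 !addn1 => le3 le4.
have {}le3 : (nneg (p ++ s) < nneg (p ++ pair ++ s))%N.
  apply: le3 => [a x y|xa _|].
  - by rewrite scaler0 addr0.
  - by rewrite braid_form_hyperbolic ?mulrNN ?mulr1 ?rpredN ?rpred1 // opprD mulN1r opprK.
  - by rewrite braid_form0 oppr0.
have {}le4 : (npos (p ++ s) < npos (p ++ pair ++ s))%N.
  apply: le4 => [a x y|xa _].
  - by rewrite scaler0 addr0.
  - by rewrite braid_form_hyperbolic ?mulr1 ?rpred1 // mul1r.
by rewrite /sig; move: le1 le2 le3 le4; lia.
Qed.

End Cancel.

(** The generating moves are applied between an arbitrary prefix and an
arbitrary suffix, which makes the induction on equivalence go through. *)
Theorem sig_braid w w' : braid_equiv w w' -> sig w = sig w'.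
Proof.
suff H : braid_equiv w w' -> forall p s, sig (p ++ w ++ s) = sig (p ++ w' ++ s).
  by move=> /H/(_ [::] [::]); rewrite !cats0.
elim=> {w w'} [//|u v _ IH|u v w _ IHu _ IHv|u u' v v' _ IHu _ IHv|i b|] p s.
- by rewrite IH.
- by rewrite IHu IHv.
- by rewrite -!catA IHu catA IHv -catA.
- exact: sig_cancel.
- exact: sig_braid_relation.
Qed.

End WordInertia.

(** * The Seifert form of the closure *)

Section SeifertForm.
Variable C : numClosedFieldType.
Local Notation stream := (nat -> C^o).

Lemma next_bandP w p q : reflect
  [/\ (p < q)%N, column w q = column w p
    & forall r, (p < r < q)%N -> column w r != column w p]
  (next_band w p q).
Proof.
apply: (iffP and3P) => [[pq /eqP cE /allP h]|[pq cE h]]; split => //.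
- by move=> r pr; apply: h; rewrite mem_iota; lia.
- exact/eqP.
by apply/allP => r; rewrite mem_iota => pr; apply: h; lia.
Qed.

Lemma next_band_inj w p q q' : next_band w p q -> next_band w p q' -> q = q'.
Proof.
move=> /next_bandP[pq cE h] /next_bandP[pq' cE' h'].
have [qq|qq|//] := ltngtP q q'.
  by have := h' q; rewrite pq qq cE eqxx => /(_ isT).
by have := h q'; rewrite pq' qq cE' eqxx => /(_ isT).
Qed.

Lemma next_band_inj_r w p p' q : next_band w p q -> next_band w p' q -> p = p'.
Proof.
move=> /next_bandP[pq cE h] /next_bandP[pq' cE' h'].
have [qq|qq|//] := ltngtP p p'.
  by have := h p'; rewrite pq' qq -cE' cE eqxx => /(_ isT).
by have := h' p; rewrite pq qq -cE cE' eqxx => /(_ isT).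
Qed.

(** The coefficients of [path_form] on paths that start at the origin. *)
Definition step_form (w : word) (p r : nat) : C :=
  if p == r then - 2 * sgn C (positive w p)
  else if column w p == column w r then 0
  else if (column w p == ord0) == (p < r)%N then 1 else - 1.

Lemma step_formC w p r : step_form w p r = step_form w r p.
Proof.
rewrite /step_form eq_sym; case: eqP => [->//|/eqP rp].
rewrite eq_sym; case: eqP => // cpr.
have -> : (r < p)%N = ~~ (p < r)%N by move: rp; case: ltngtP.
move: cpr; have [->|->] := ordP (column w p); have [->|->] := ordP (column w r);
  by case: (p < r)%N.
Qed.

Lemma disp_sum i w (x : stream) :
  disp i w x = \sum_(k < size w) (column w k == i)%:R * x k.
Proof.
elim: w x => [|c w IH] x /=; first by rewrite big_ord0.
rewrite big_ord_recl IH /=; congr (_ + _).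
by rewrite /column /=; case: eqP; rewrite ?mul1r ?mul0r.
Qed.

Lemma path_form_steps w (x : stream) : path_form w 0 0 x
  = \sum_(p < size w) \sum_(r < size w) step_form w p r * (x p * (x r)^*).
Proof.
elim: w x => [|c w IH] x /=; first by rewrite big_ord0.
rewrite big_ord_recl big_ord_recl /=.
have -> : \sum_(i < size w) \sum_(r < (size w).+1)
    step_form (c :: w) (lift ord0 i) r * (x (lift ord0 i) * (x r)^*)
  = \sum_(i < size w) step_form (c :: w) 0 i.+1 * (x i.+1 * (x 0%N)^*)
   + path_form w 0 0 (stail 1 x).
  rewrite IH -big_split; apply: eq_bigr => i _; rewrite big_ord_recl /=; congr (_ + _).
  by rewrite step_formC.
have z0 : step_form (c :: w) 0 0 = - 2 * sgn C c.2 by rewrite /step_form eqxx.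
rewrite z0.
have fE (i j : 'I_2) (k : C) : c.1 = i -> j != i ->
    (if i == ord0 then 1 else -1) = k ->
    \sum_(i < size w) step_form (c :: w) 0 i.+1 * (x i.+1 * (x 0%N)^*)
      = k * (disp j w (stail 1 x) * (x 0%N)^*)
    /\ \sum_(i < size w) step_form (c :: w) 0 i.+1 * (x 0%N * (x i.+1)^*)
      = k * ((disp j w (stail 1 x))^* * x 0%N).
  move=> ci ji kE; have sE (r : nat) : step_form (c :: w) 0 r.+1 = k * (column w r == j)%:R.
    rewrite /step_form /= -[column _ r.+1]/(column w r) -[column _ 0]/c.1 ci -kE.
    move: ji; have [->|->] := ordP i; have [->|->] := ordP j;
    have [->|->] := ordP (column w r); rewrite //= ?mulr1 ?mulr0 //.
  rewrite disp_sum rmorph_sum !mulr_suml !mulr_sumr; split; apply: eq_bigr => r _.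
    by rewrite sE /stail add1n; ring.
  by rewrite sE rmorphM rmorph_nat /stail add1n; ring.
have [c0|c1] := ordP c.1.
  have [-> ->] := fE ord0 ord_max 1 c0 isT erefl.
  rewrite c0 /= dot0r -[x 0%N in X in path_form _ X _]add0r -[X in path_form w _ X]addr0.
  rewrite add0r -[x 0%N in X in path_form _ X _]add0r path_form_shift /dot.
  by rewrite rmorph0; ring.
have [-> ->] := fE ord_max ord0 (-1) c1 isT erefl.
rewrite c1 /= dot0r -[X in path_form w X _ _]addr0 path_form_shift /dot.
by rewrite rmorph0; ring.
Qed.

(** A loop is the difference of the steps of its two bands, so the symmetrized
linking numbers are second differences of [step_form].  For loops of distinct
columns, the value depends on how the four bands interleave. *)
Lemma linking_symmetrized w p q r s : next_band w p q -> next_band w r s ->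
  2 * ((linking w (p, q) (r, s))%:~R + (linking w (r, s) (p, q))%:~R)
  = step_form w p r - step_form w p s - step_form w q r + step_form w q s.
Proof.
wlog pr : p q r s / (p <= r)%N => [H|] npq nrs.
  have [pr|/ltnW rp] := leqP p r; first exact: H.
  rewrite addrC H // [step_form w r p]step_formC [step_form w r q]step_formC.
  by rewrite [step_form w s p]step_formC [step_form w s q]step_formC; ring.
have /next_bandP[pq cq between] := npq; have /next_bandP[rs cs between'] := nrs.
have [cpr|cpr] := eqVneq (column w p) (column w r).
  have same a b : column w a = column w p -> column w b = column w p -> a != b ->
      step_form w a b = 0.
    by move=> ca cb /negPf ab; rewrite /step_form ab ca cb eqxx.
  have [pr'|pr'] := eqVneq p r.
    subst r; rewrite -(next_band_inj npq nrs) /linking eqxx /step_form !eqxx.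
    rewrite (gtn_eqF pq) (ltn_eqF pq) cq eqxx /crossing_sign /sgn /=.
    have half : [/\ ((1 + 1) %/ 2)%Z = 1, ((1 + -1) %/ 2)%Z = 0,
      ((-1 + 1) %/ 2)%Z = 0 & ((-1 + -1) %/ 2)%Z = -1 :> int] by [].
    have [h1 h2 h3 h4] := half.
    case: (positive w p); case: (positive w q); rewrite /= ?(h1, h2, h3, h4);
      rewrite ?(rmorphN, rmorph0, rmorph1) /=; ring.
  have {}pr : (p < r)%N by rewrite ltn_neqAle pr'.
  have qr : (q <= r)%N.
    rewrite leqNgt; apply/negP => rq; have := between r.
    by rewrite pr rq cpr eqxx => /(_ isT).
  have ps : (p < s)%N by lia.
  have qs : (q < s)%N by lia.
  rewrite /linking !xpair_eqE (gtn_eqF pr) (ltn_eqF pr) /= cpr eqxx.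
  rewrite (gtn_eqF ps) (same p r) ?(ltn_eqF pr) // (same p s) ?(ltn_eqF ps) ?cs //.
  rewrite (same q s) ?(ltn_eqF qs) ?cs //.
  have [qr'|qr'] := eqVneq q r.
    subst r; rewrite /step_form eqxx /sgn.
    by case: (positive w q); rewrite /=; ring.
  by rewrite same //=; ring.
have neq a b : column w a = column w p -> column w b = column w r -> a != b.
  by move=> ca cb; apply: contraNneq cpr => ab; rewrite -ca -cb ab.
have pr' := neq p r erefl erefl; have ps' := neq p s erefl cs.
have qr' := neq q r cq erefl; have qs' := neq q s cq cs.
have rp' : (r == p) = false by rewrite eq_sym; apply/negbTE.
rewrite /linking !xpair_eqE rp' (negPf pr') /= /step_form.
rewrite !(negPf pr', negPf ps', negPf qr', negPf qs') !(cs, cq) (negPf cpr).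
rewrite [column w r == _]eq_sym (negPf cpr).
have {}pr : (p < r)%N by rewrite ltn_neqAle pr'.
rewrite pr (ltn_trans pr rs) [(r < p)%N]ltnNge (ltnW pr) /=.
have {cpr}: column w p != column w r by [].
have [->|->] := ordP (column w p); have [->|->] := ordP (column w r) => //= _;
  by case: (ltngtP q r) qr'; case: (ltngtP q s) qs' => //= *; try (exfalso; lia); ring.
Qed.

Section Loops.
Variable w : word.
Local Notation m := (size (loops w)).

Definition rise (i : 'I_m) := (nth (0, 0)%N (loops w) i).1.
Definition fall (i : 'I_m) := (nth (0, 0)%N (loops w) i).2.

Lemma mem_loops p q : ((p, q) \in loops w) = next_band w p q && (q < size w)%N.
Proof.
rewrite mem_filter /=; case: (boolP (next_band w p q)) => //= /next_bandP[pq _ _].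
apply/allpairsP/idP => [[[p' q'] [_]]|qw].
  by rewrite mem_iota /= => qw [_ ->].
by exists (p, q); rewrite /= !mem_iota /= (ltn_trans pq qw).
Qed.

Lemma uniq_loops : uniq (loops w).
Proof.
apply: filter_uniq; apply: allpairs_uniq; rewrite ?iota_uniq //.
by move=> [? ?] [? ?] _ _ [-> ->].
Qed.

Lemma next_band_loop i : next_band w (rise i) (fall i) && (fall i < size w)%N.
Proof. by rewrite -mem_loops -surjective_pairing mem_nth. Qed.

(** The path drawn by a combination of loops: each loop goes up one band and
down the next one of the same column. *)
Definition boundary (y : 'rV[C]_m) : stream := fun k =>
  \sum_i y 0 i * ((k == rise i)%:R - (k == fall i)%:R).

Lemma boundary_sum (F : nat -> C) y : \sum_(p < size w) F p * boundary y p
  = \sum_i y 0 i * (F (rise i) - F (fall i)).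
Proof.
have pick k : (k < size w)%N -> \sum_(p < size w) F p * (p == k :> nat)%:R = F k.
  move=> kw; rewrite (bigD1 (Ordinal kw)) //= eqxx mulr1 big1 ?addr0 // => p.
  by rewrite -val_eqE /= => /negPf ->; rewrite mulr0.
under eq_bigr do rewrite mulr_sumr.
rewrite exchange_big; apply: eq_bigr => i _ /=.
have /andP[/next_bandP[lt_i _ _] fw] := next_band_loop i.
rewrite -(pick _ fw) -(pick (rise i)); last exact: ltn_trans fw.
by rewrite -sumrB mulr_sumr; apply: eq_bigr => p _; ring.
Qed.

Lemma boundary_sumC (F : nat -> C) y : \sum_(p < size w) F p * (boundary y p)^*
  = \sum_i (y 0 i)^* * (F (rise i) - F (fall i)).
Proof.
apply: (can_inj conjCK); rewrite !rmorph_sum /=.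
under eq_bigr do rewrite rmorphM /= conjCK.
under [RHS]eq_bigr do rewrite rmorphM /= conjCK rmorphB.
exact: (boundary_sum (fun p => (F p)^*)).
Qed.

Definition loop_matrix : 'M[C]_m :=
  let V := map_mx (intr : int -> C) (seifert_matrix w) in
  (1 - (-1)) *: V + (1 - (-1)^-1) *: V^T.

Lemma loop_matrixE i j : loop_matrix i j
  = step_form w (rise i) (rise j) - step_form w (rise i) (fall j)
    - step_form w (fall i) (rise j) + step_form w (fall i) (fall j).
Proof.
have /andP[ni _] := next_band_loop i; have /andP[nj _] := next_band_loop j.
rewrite -(linking_symmetrized ni nj) !mxE invrN1 opprK mulrDr.
by rewrite /rise /fall -!surjective_pairing.
Qed.

Lemma loop_matrix_herm : map_mx Num.conj loop_matrix^T = loop_matrix.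
Proof.
apply/matrixP => i j; rewrite !mxE invrN1 opprK !rmorphD !rmorphM /= !rmorph_int.
by rewrite rmorphD rmorph1; ring.
Qed.

Definition loop_path (y : 'rV[C]_m) : stream :=
  fun k => if k is k'.+2 then boundary y k' else 0.

Lemma loop_form y : mxform loop_matrix y = braid_form w (loop_path y).
Proof.
rewrite /braid_form -[stail _ _]/(boundary y) path_form_steps.
transitivity (\sum_(p < size w) (\sum_(r < size w) step_form w p r * (boundary y r)^*)
  * boundary y p);
  last first.
  apply: eq_bigr => p _; rewrite mulr_suml; apply: eq_bigr => r _; ring.
rewrite (boundary_sum (fun p => \sum_(r < size w) step_form w p r * (boundary y r)^*)).
rewrite /mxform mxE; under eq_bigr do rewrite mxE mulr_suml.
rewrite exchange_big; apply: eq_bigr => i _ /=.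
rewrite !boundary_sumC -sumrB mulr_sumr; apply: eq_bigr => j _.
by rewrite loop_matrixE !mxE; ring.
Qed.

Lemma linear_loop_path : linear loop_path.
Proof.
move=> a x y; apply/funext => -[|[|k]] /=.
- by rewrite -[RHS]/(a * 0 + 0 : C) mulr0 addr0.
- by rewrite -[RHS]/(a * 0 + 0 : C) mulr0 addr0.
rewrite -[RHS]/(a * boundary x k + boundary y k) /boundary mulr_sumr -big_split.
by apply: eq_bigr => i _; rewrite !mxE /=; ring.
Qed.

(** The coefficient of the loop that leaves along the band [k] in a closed path:
what the path has climbed in the column of [k] so far. *)
Definition climb (x : stream) (k : nat) : C := disp (column w k) (take k.+1 w) x.

Lemma disp_take i k (x : stream) : (k < size w)%N ->
  disp i (take k.+1 w) x = disp i (take k w) x + (column w k == i)%:R * x k.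
Proof.
move=> kw; rewrite (take_nth s1 kw) -cats1 disp_cat /= addr0 size_takel; last exact: ltnW.
by rewrite /stail addn0 -/(column w k); case: eqP => _; rewrite ?mul1r ?mul0r.
Qed.

Lemma disp_idle i a b (x : stream) : (a <= b <= size w)%N ->
  (forall r, (a <= r < b)%N -> column w r != i) ->
  disp i (take b w) x = disp i (take a w) x.
Proof.
elim: b => [|b IH] /andP[ab bw] h; first by move: ab; rewrite leqn0 => /eqP ->.
move: ab; rewrite leq_eqVlt => /orP[/eqP->//|ab].
rewrite disp_take // (negPf (h b _)) ?mul0r ?addr0; last by lia.
by apply: IH => [|r ra]; [lia|apply: h; lia].
Qed.

Lemma last_before i q : (exists2 p, (p < q)%N & column w p = i
    /\ forall r, (p < r < q)%N -> column w r != i)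
  \/ (forall r, (r < q)%N -> column w r != i).
Proof.
elim: q => [|q IH]; first by right.
have [ci|ci] := eqVneq (column w q) i.
  by left; exists q => //; split=> // r; lia.
case: IH => [[p pq [cp h]]|h]; [left; exists p; first exact: leqW|right].
  split=> // r /andP[pr rq]; have [->//|rq'] := eqVneq r q.
  by apply: h; lia.
by move=> r rq; have [->//|rq'] := eqVneq r q; apply: h; lia.
Qed.

Lemma first_after i p n : (exists2 q, (p < q < n)%N & column w q = i
    /\ forall r, (p < r < q)%N -> column w r != i)
  \/ (forall r, (p < r < n)%N -> column w r != i).
Proof.
elim: n => [|n [[q pq cq]|IH]]; first by right => r; lia.
  by left; exists q => //; lia.
have [pn|pn] := leqP n p; first by right => r; lia.
have [ci|ci] := eqVneq (column w n) i.
  by left; exists n; [lia|split].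
right=> r rn; have [->//|rn'] := eqVneq r n; apply: IH; lia.
Qed.

Lemma loop_index p q : next_band w p q -> (q < size w)%N ->
  exists i : 'I_m, rise i = p /\ fall i = q.
Proof.
move=> npq qw; have pqm : (p, q) \in loops w by rewrite mem_loops npq.
have im : (index (p, q) (loops w) < m)%N by rewrite index_mem.
by exists (Ordinal im); rewrite /rise /fall nth_index.
Qed.

Lemma loop_inj i j : rise i = rise j -> fall i = fall j -> i = j.
Proof.
move=> rE fE; apply/val_inj/eqP.
rewrite -(nth_uniq (0, 0)%N (ltn_ord i) (ltn_ord j) uniq_loops); apply/eqP.
rewrite [LHS]surjective_pairing [RHS]surjective_pairing.
by congr pair.
Qed.

Definition loop_coord (x : stream) : 'rV[C]_m := \row_i climb (stail 2 x) (rise i).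

(** A closed path is a combination of loops.  In each column the consecutive
differences of the partial displacements are the steps; the first band has no
predecessor, and the last one no successor, where the total displacement
vanishes. *)
Lemma boundary_climb x k : (k < size w)%N ->
  disp ord0 w (stail 2 x) = 0 -> disp ord_max w (stail 2 x) = 0 ->
  boundary (loop_coord x) k = stail 2 x k.
Proof.
move=> kw d0 d1; set z := stail 2 x in d0 d1 *.
have dz i : disp i w z = 0 by have [->|->] := ordP i.
rewrite /boundary; under eq_bigr do rewrite mxE mulrBr.
rewrite sumrB.
have -> : \sum_i climb z (rise i) * (k == rise i)%:R = climb z k.
  have [[q /andP[kq qw] [cq h]]|h] := first_after (column w k) k (size w).
    have nkq : next_band w k q by apply/next_bandP.
    have [i [ri fi]] := loop_index nkq qw.
    rewrite (bigD1 i) //= ri eqxx mulr1 big1 ?addr0 // => j ji.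
    case: eqP => [kj|]; rewrite ?mulr0 //; case/eqP: ji.
    have /andP[nj _] := next_band_loop j; rewrite -kj in nj.
    by apply: loop_inj; rewrite ?ri ?fi // (next_band_inj nkq nj).
  rewrite big1 => [|j _].
    rewrite /climb -(@disp_idle _ k.+1 (size w)); [|by rewrite kw leqnn|].
      by rewrite take_size dz.
    by move=> r /andP[kr rw]; apply: h; rewrite kr.
  case: eqP => [kj|]; rewrite ?mulr0 //.
  have /andP[/next_bandP[lt_j cj _] fw] := next_band_loop j.
  by have := h (fall j); rewrite kj lt_j fw cj eqxx => /(_ isT).
have -> : \sum_i climb z (rise i) * (k == fall i)%:R = disp (column w k) (take k w) z.
  have [[p pk [cp h]]|h] := last_before (column w k) k.
    have npk : next_band w p k by apply/next_bandP; split=> //; rewrite cp.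
    have [i [ri fi]] := loop_index npk kw.
    rewrite (bigD1 i) //= fi eqxx mulr1 big1 ?addr0 => [|j ji].
      by rewrite ri /climb cp; apply/esym/disp_idle => //; rewrite pk ltnW.
    case: eqP => [kj|]; rewrite ?mulr0 //; case/eqP: ji.
    have /andP[nj _] := next_band_loop j; rewrite -kj in nj.
    by apply: loop_inj; rewrite ?ri ?fi // (next_band_inj_r npk nj).
  rewrite big1 => [|j _].
    by rewrite (@disp_idle _ 0 k) ?take0 //= ltnW.
  case: eqP => [kj|]; rewrite ?mulr0 //.
  have /andP[/next_bandP[lt_j cj _] fw] := next_band_loop j.
  by have := h (rise j); rewrite kj lt_j -cj eqxx => /(_ isT).
by rewrite /climb disp_take // eqxx mul1r addrC addKr.
Qed.

Lemma linear_loop_coord : linear loop_coord.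
Proof.
move=> a x y; apply/rowP => i; rewrite !mxE.
exact: disp_stail_lin.
Qed.

(** Combinations of loops are the paths that are closed and start at the origin:
four conditions, each of which costs one in either index. *)
Lemma word_signature_sig : `|word_signature w (-1 : C) - sig C w| <= 8.
Proof.
pose l (i : 'I_4) (x : stream) : C^o := nth (0 : C^o)
  [:: x 0%N; x 1%N; disp ord0 w (stail 2 x); disp ord_max w (stail 2 x)] i.
have llin i : linear (l i).
  case: i => -[|[|[|[|//]]]] ? /=; rewrite /l //=.
  - exact: (linear_disp ord0 w (linear_stail 2 (@linear_idfun C stream))).
  - exact: (linear_disp ord_max w (linear_stail 2 (@linear_idfun C stream))).
have closed x : (forall i, l i x = 0) -> braid_form w x = mxform loop_matrix (loop_coord x).
  move=> lx; have := lx 0; have := lx 1; have := lx (inord 2); have := lx (inord 3).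
  rewrite /l !inordK //= => d1 d0 v0 u0; rewrite loop_form.
  rewrite /braid_form u0 v0; apply: path_form_eq => k kw.
  by rewrite [RHS]boundary_climb.
have pos := mxform_has_pos loop_matrix_herm; have neg := mxform_has_neg loop_matrix_herm.
have [le1 le2] := index_le linear_loop_coord llin closed (npos_has C w) (nneg_has C w) pos neg.
have [le3 le4] := @index_le _ _ _ _ _ loop_path 0 (fun _ _ => 0) _ _ _ _ linear_loop_path
  (fun i => ltac:(by case: i)) (fun x _ => loop_form x) pos neg (npos_has C w) (nneg_has C w).
rewrite /word_signature /= -/loop_matrix /signature /sig.
have -> : #|[set i | 0 < spectral_diag loop_matrix 0 i]|
    = #|[set i | 0 < spectral_diag loop_matrix 0 i]%SET|.
  by apply: eq_card => i; rewrite !inE; apply/asboolP/idP.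
have -> : #|[set i | spectral_diag loop_matrix 0 i < 0]|
    = #|[set i | spectral_diag loop_matrix 0 i < 0]%SET|.
  by apply: eq_card => i; rewrite !inE; apply/asboolP/idP.
move: le1 le2 le3 le4; move: #|_| #|_| (npos C w) (nneg C w) => a b p n.
by clear; lia.
Qed.

End Loops.
End SeifertForm.

(** * Alternating words and full twists *)

Section Models.
Variable C : numClosedFieldType.
Local Notation stream := (nat -> C^o).

(** Collects functionals one block at a time, in inductions over words. *)
Lemma pos_le_cat (V : lmodType C) k m (g : V -> 'rV[C]_k) (l : 'I_m -> V -> C^o) :
  linear g -> (forall i, linear (l i)) ->
  exists2 h : V -> 'rV[C]_(m + k), linear h
    & forall x, h x = 0 -> g x = 0 /\ forall i, l i x = 0.
Proof.
move=> glin llin; exists (fun x => row_mx (\row_i l i x) (g x)) => [a x y|x].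
  by rewrite glin (linear_row llin) scale_row_mx add_row_mx.
rewrite -row_mx0 => /eq_row_mx[/rowP h ->]; split=> // i.
by move: (h i); rewrite !mxE.
Qed.

Lemma linear_at k : linear (fun x : stream => x k).
Proof. by []. Qed.

Lemma linear_at_tail (V : lmodType C) m (g : stream -> V) :
  linear g -> linear (fun x => g (stail m x)).
Proof. by move=> glin a x y; exact: (glin a (stail m x) (stail m y)). Qed.

(** If the steps of the other column vanish, then so does the area, and what
remains is a sum of squares with a constant sign. *)
Lemma one_column_form (j : 'I_2) (b : bool) (w : word) :
  all (fun c => (c.1 == j) ==> (c.2 == b)) w ->
  exists2 g : stream -> 'rV[C]_(count (fun c => c.1 != j) w), linear g &
    forall u v x, (if j == ord0 then v else u) = 0 -> g x = 0 ->
      sgn C b * path_form w u v x <= 0.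
Proof.
elim: w => [|c w IH] /=.
  by exists (fun=> 0) => [a x y|u v x _ _]; rewrite ?scaler0 ?addr0 ?mulr0.
move=> /andP[cb /IH [g glin gneg]].
have [cj|cj] := eqVneq c.1 j; last first.
  have [h hlin hE] := @pos_le_cat _ _ 1 (fun x => g (stail 1 x)) (fun _ x => x 0%N)
    (linear_at_tail _ glin) (fun _ => linear_at 0).
  exists h => // u v x uv0 /hE[gx /(_ 0) x0].
  rewrite x0 !dot0l mulr0 oppr0 !add0r !addr0.
  by case: ifP => _; exact: gneg.
exists (fun x => g (stail 1 x)) => [|u v x uv0 gx].
  exact: linear_at_tail.
move: cb; rewrite cj eqxx => /eqP ->.
have sb2 : sgn C b * sgn C b = 1 by rewrite /sgn; case: (b); rewrite ?mulrNN mulr1.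
rewrite mulrDr mulrA mulrN sb2 mulN1r.
have pos := dotxx_ge0 (x 0%N).
have [j0|j1] := ordP j; move: uv0; rewrite ?j0 ?j1 /= => ->.
  rewrite dot0r oppr0 add0r -oppr_ge0 opprD opprK addr_ge0 // oppr_ge0.
  by apply: gneg => //; rewrite j0.
rewrite dot0r add0r -oppr_ge0 opprD opprK addr_ge0 // oppr_ge0.
by apply: gneg => //; rewrite j1.
Qed.

Lemma one_column_le (j : 'I_2) (b : bool) (w : word) :
  all (fun c => (c.1 == j) ==> (c.2 == b)) w ->
  ((if b then npos C w else nneg C w) <= 1 + count (fun c => c.1 != j) w)%N.
Proof.
move=> /one_column_form [g glin gneg].
(* the additional functional fixes the coordinate that the steps of column [j] pair with *)
have [h hlin hE] := @pos_le_cat _ _ 1 (fun x => g (stail 2 x))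
  (fun _ x => x (if j == ord0 then 1%N else 0%N))
  (linear_at_tail _ glin) (fun _ => linear_at _).
case: b gneg => gneg.
  apply: (pos_ge_le (npos_has C w).1); exists h; split=> // x /hE[gx /(_ 0) j0].
  rewrite -[X in X <= _]mul1r; apply: gneg => //.
  by move: j0; case: ifP.
apply: (pos_ge_le (nneg_has C w).1); exists h; split=> // x /hE[gx /(_ 0) j0].
rewrite -[X in X <= _]mulN1r; apply: gneg => //.
by move: j0; case: ifP.
Qed.

Definition other (i : 'I_2) : 'I_2 := if i == ord0 then ord_max else ord0.

Definition alternating (i : 'I_2) (s : seq bool) : word :=
  [seq if e then (i, true) else (other i, false) | e <- s].

Lemma other_neq i : (other i == i) = false.
Proof. by have [->|->] := ordP i. Qed.

(** By [one_column_le] both indices are bounded above by letter counts that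
add up to the length, and by [nullity] they almost exhaust it. *)
Lemma sig_alternating i s :
  `|sig C (alternating i s) - ((count negb s)%:Z - (count id s)%:Z)| <= 4.
Proof.
have a1 : all (fun c => (c.1 == i) ==> (c.2 == true)) (alternating i s).
  by rewrite all_map; apply/allP => -[] _ /=; rewrite ?implybT // other_neq.
have a2 : all (fun c => (c.1 == other i) ==> (c.2 == false)) (alternating i s).
  by rewrite all_map; apply/allP => -[] _ /=; rewrite ?implybT // eq_sym other_neq.
have := one_column_le a1; have := one_column_le a2.
have := nullity C (alternating i s); rewrite /sig size_map -(count_predC id s).
have -> : count (fun c => c.1 != i) (alternating i s) = count negb s.
  by rewrite count_map; apply: eq_count => -[] /=; rewrite ?eqxx // other_neq.
have -> : count (fun c => c.1 != other i) (alternating i s) = count id s.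
  by rewrite count_map; apply: eq_count => -[] /=; rewrite ?eqxx // eq_sym other_neq.
rewrite -[count (predC id) s]/(count negb s).
by move=> h h1 h2; lia.
Qed.

Definition delta_word : word := [:: s1; s2; s1].
Definition full_twist : word := delta_word ++ delta_word.

(** Minus a sum of four squares: the full twist is negative on the paths that start
on the axis of column 1 and come back to it. *)
Lemma full_twist_form v (x : stream) : disp ord0 full_twist x = 0 ->
  path_form full_twist 0 v x = - (dot (x 0%N - x 1%N) (x 0%N - x 1%N)
    + dot (x 4%N + x 5%N) (x 4%N + x 5%N) + dot (x 2%N) (x 2%N) + dot (x 3%N) (x 3%N)).
Proof.
rewrite /full_twist /delta_word /= /stail /= !add0r !addr0 => U0.
have -> : x 5%N = - (x 0%N + x 2%N + x 3%N).
  by apply/eqP; rewrite -addr_eq0 addrC; apply/eqP; move: U0 => <-; ring.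
by rewrite /dot !(rmorphD, rmorphN) /=; ring.
Qed.

(** The twists decouple: after one of them has closed up in column 0, the next
one starts from the same first coordinate. *)
Lemma twist_power_form (e : C) m (l : 'I_m -> stream -> C^o) :
  (forall i, linear (l i)) ->
  (forall v x, (forall i, l i x = 0) ->
    disp ord0 full_twist x = 0 /\ e * path_form full_twist 0 v x <= 0) ->
  forall k, exists2 g : stream -> 'rV[C]_(k * m), linear g &
    forall v x, g x = 0 -> e * path_form (flatten (nseq k full_twist)) 0 v x <= 0.
Proof.
move=> llin le0; elim=> [|k [g glin gneg]].
  by exists (fun=> 0) => [a x y|v x _]; rewrite ?scaler0 ?addr0 //= mulr0.
have [h hlin hE] := @pos_le_cat _ _ m (fun x => g (stail 6 x)) l
  (linear_at_tail _ glin) llin.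
exists h => // v x /hE[gx /(le0 v)[d0 le1]].
rewrite -[flatten _]/(full_twist ++ flatten (nseq k full_twist)).
rewrite path_form_cat d0 addr0 mulrDr -oppr_ge0 opprD addr_ge0 ?oppr_ge0 //.
exact: gneg.
Qed.

Lemma pos_twist k : (npos C (flatten (nseq k full_twist)) <= 1 + k)%N.
Proof.
have [|v x h|g glin gneg] := @twist_power_form 1 1 (fun _ x => disp ord0 full_twist x) _ _ k.
- by move=> _; exact: (linear_disp _ _ (@linear_idfun C stream)).
- have d0 := h 0; split=> //; rewrite mul1r full_twist_form // oppr_le0.
  have p := @dotxx_ge0 C.
  exact: (addr_ge0 (addr_ge0 (addr_ge0 (p _) (p _)) (p _)) (p _)).
have [h hlin hE] := @pos_le_cat _ _ 1 (fun x => g (stail 2 x)) (fun _ x => x 0%N)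
  (linear_at_tail _ glin) (fun _ => linear_at 0).
rewrite -[k]muln1; apply: (pos_ge_le (npos_has C _).1).
exists h; split=> // x /hE[gx /(_ 0) x0].
by rewrite muln1 /braid_form x0 -[X in X <= _]mul1r; exact: gneg.
Qed.

Lemma neg_twist k : (nneg C (flatten (nseq k full_twist)) <= 1 + k * 5)%N.
Proof.
pose l (i : 'I_5) (x : stream) : C^o := nth 0 [:: disp ord0 full_twist x;
  x 0%N - x 1%N; x 4%N + x 5%N; x 2%N; x 3%N] i.
have llin i : linear (l i).
  case: i => -[|[|[|[|[|//]]]]] ? a x y; rewrite /l /=; try exact: stream_lin.
  - by rewrite /stail !stream_lin /GRing.scale /=; ring.
  - by rewrite !stream_lin /GRing.scale /=; ring.
  - by rewrite !stream_lin /GRing.scale /=; ring.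
have [|g glin gneg] := @twist_power_form (-1) 5 l llin _ k.
  move=> v x h; have d0 : disp ord0 full_twist x = 0 := h 0.
  split=> //; rewrite full_twist_form //.
  have := h (Ordinal (isT : 1 < 5)%N); have := h (Ordinal (isT : 2 < 5)%N).
  have := h (Ordinal (isT : 3 < 5)%N); have := h (Ordinal (isT : 4 < 5)%N).
  by rewrite /l => /= -> -> -> ->; rewrite dot0l !addr0 oppr0 mulr0.
have [h hlin hE] := @pos_le_cat _ _ 1 (fun x => g (stail 2 x)) (fun _ x => x 0%N)
  (linear_at_tail _ glin) (fun _ => linear_at 0).
apply: (pos_ge_le (nneg_has C _).1).
exists h; split=> // x /hE[gx /(_ 0) x0].
by rewrite /braid_form x0 -[X in X <= _]mulN1r; exact: gneg.
Qed.

(** The two upper bounds on the indices leave no room: [k] positive directions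
and [5 * k] negative ones, out of [6 * k] steps. *)
Lemma sig_twist k : `|sig C (flatten (nseq k full_twist)) + 4 * k%:Z| <= 4.
Proof.
have := pos_twist k; have := neg_twist k.
have := nullity C (flatten (nseq k full_twist)).
have -> : size (flatten (nseq k full_twist)) = (6 * k)%N.
  by rewrite size_flatten /shape map_nseq sumn_nseq.
by rewrite /sig; lia.
Qed.

Definition delta_power (j : nat) : word := flatten (nseq j delta_word).

Lemma sig_delta : exists K : int, forall j, `|sig C (delta_power j) + 2 * j%:Z| <= K.
Proof.
exists (8 + `|sig C delta_word|) => j.
have jE : delta_power j
    = flatten (nseq j./2 full_twist) ++ (if odd j then delta_word else [::]).
  rewrite -{1}(odd_double_half j) addnC /delta_power nseqD flatten_cat.
  congr (_ ++ _); last by case: (odd j).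
  elim: (j./2) => // k IH; rewrite doubleS.
  by rewrite -[LHS]/(delta_word ++ delta_word ++ flatten (nseq k.*2 delta_word)) IH /=.
have tw := sig_twist j./2.
have := odd_double_half j; rewrite jE; case: (odd j) => /= jj.
  by have := sig_cat C (flatten (nseq j./2 full_twist)) delta_word; lia.
by rewrite cats0; lia.
Qed.

Lemma sig_normal : exists K : int, forall i s j,
  `|sig C (alternating i s ++ delta_power j)
    + (2 * j%:Z + (count id s)%:Z - (count negb s)%:Z)| <= K.
Proof.
have [K hK] := sig_delta; exists (K + 6) => i s j.
have := sig_cat C (alternating i s) (delta_power j).
by have := hK j; have := sig_alternating i s; lia.
Qed.

End Models.

(** * Normal forms of positive braids *)

Section NormalForm.
Local Open Scope group_scope.

Definition gen (i : 'I_2) : Br3 := braid [:: (i, true)].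
Definition Delta : Br3 := braid delta_word.

Lemma braid_catE u v : braid (u ++ v) = braid u * braid v.
Proof. exact/esym/braid_mulE. Qed.

Lemma braid_nil : braid [::] = 1 :> Br3. Proof. by []. Qed.

Lemma Delta_gen i : gen i * gen (other i) * gen i = Delta.
Proof.
rewrite /gen -!braid_catE; have [->|->] := ordP i; first exact: erefl.
exact/esym/braidP/braid_relation.
Qed.

Lemma otherK : involutive other.
Proof. by move=> i; have [->|->] := ordP i. Qed.

Lemma Delta_comm i : Delta * gen i = gen (other i) * Delta.
Proof. by rewrite -{1}(Delta_gen (other i)) otherK -(Delta_gen i) !mulgA. Qed.

Definition twist (j : nat) (i : 'I_2) : 'I_2 := if odd j then other i else i.

Lemma Delta_power_comm j i : Delta ^+ j * gen i = gen (twist j i) * Delta ^+ j.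
Proof.
elim: j i => [|j IH] i; first by rewrite !expg0 mul1g mulg1.
rewrite expgS -mulgA IH mulgA Delta_comm mulgA; congr (gen _ * _ * _).
by rewrite /twist /=; case: (odd j); rewrite /= ?otherK.
Qed.

Lemma gen_inv i : braid [:: (i, false)] = (gen i)^-1.
Proof.
apply: (mulgI (gen i)); rewrite mulgV -braid_catE.
exact/braidP/(braid_cancel i true).
Qed.

Lemma braid_delta_power j : braid (delta_power j) = Delta ^+ j.
Proof.
elim: j => [|j IH] //.
by rewrite -[delta_power _]/(delta_word ++ delta_power j) braid_catE IH expgS.
Qed.

(** The braid [realize] of such a record: the signs of the stack, bottom first,
are the letters of an alternating word, positive on the generator [axis] and
negative on the other one; then comes a power of [Delta]. *)
Record normal := Normal { axis : 'I_2; stack : seq bool; exponent : nat }.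

Definition realize (x : normal) : word :=
  alternating (axis x) (rev (stack x)) ++ delta_power (exponent x).

(** Right multiplication by a generator, renamed by its passage through the power
of [Delta].  A letter of the axis extends the stack; the other generator cancels
a negative top, and completes a positive top to [Delta], at the price of a
negative letter. *)
Definition push (x : normal) (i : 'I_2) : normal :=
  let i' := twist (exponent x) i in
  match stack x with
  | [::] => Normal i' [:: true] (exponent x)
  | e :: s =>
    if i' == axis x then Normal (axis x) [:: true, e & s] (exponent x)
    else if e then Normal (axis x) (false :: s) (exponent x).+1
    else Normal (axis x) s (exponent x)
  end.

Lemma alternating_rcons i s e : braid (alternating i (rev (e :: s)))
  = braid (alternating i (rev s)) * (if e then gen i else (gen (other i))^-1).
Proof.
rewrite rev_cons /alternating map_rcons -cats1 braid_catE; congr (_ * _).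
by case: e => //; rewrite gen_inv.
Qed.

Lemma realize_push x i : braid (realize (push x i)) = braid (realize x) * gen i.
Proof.
case: x => a s j; rewrite /push /realize /= !braid_catE !braid_delta_power -!mulgA.
rewrite Delta_power_comm; set i' := twist j i.
case: s => [|e s]; first by rewrite /= braid_nil mul1g.
have [->|ia] := eqVneq i' a.
  by rewrite /= [in LHS]alternating_rcons -mulgA.
have -> : i' = other a.
  by move: ia; have [->|->] := ordP i'; have [->|->] := ordP a.
case: e; rewrite /= !alternating_rcons -!mulgA;
  congr (_ * _).
  apply: (mulgI (gen (other a))); rewrite mulKVg expgS -(Delta_gen (other a)) otherK.
  by rewrite !mulgA.
by rewrite mulKg.
Qed.

Fixpoint run (x : normal) (s : seq 'I_2) : normal :=
  if s is i :: s' then run (push x i) s' else x.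

Lemma realize_run x s :
  braid (realize (run x s)) = braid (realize x) * braid [seq (i, true) | i <- s].
Proof.
elim: s x => [|i s IH] x /=; first by rewrite -braid_catE cats0.
by rewrite IH realize_push -mulgA -cat1s [X in _ = _ * X]braid_catE.
Qed.

Local Open Scope ring_scope.

(** Minus the signature, up to a constant. *)
Definition height (x : normal) : int :=
  2 * (exponent x)%:Z + (count id (stack x))%:Z - (count negb (stack x))%:Z.

Theorem sig_run (C : numClosedFieldType) : exists K : int, forall w s,
  braid_equiv w [seq (i, true) | i <- s] ->
  `|sig C w + height (run (Normal ord0 [::] 0) s)| <= K.
Proof.
have [K hK] := sig_normal C; exists K => w s ws.
have /braidP/(@sig_braid C) <- : braid (realize (run (Normal ord0 [::] 0) s)) = braid w.
  rewrite realize_run braid_nil mul1g.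
  by apply/braidP/braid_sym.
set x := run _ _; rewrite /realize /height.
have := hK (axis x) (rev (stack x)) (exponent x).
by rewrite !count_rev.
Qed.

End NormalForm.

(** * The height of a random word *)

Section Walk.
Variable R : realType.

(** The average over the uniform measure on bit strings of length [n]. *)
Fixpoint mean (n : nat) (F : seq bool -> R) : R :=
  if n is n'.+1 then
    (mean n' (fun v => F (true :: v)) + mean n' (fun v => F (false :: v))) / 2
  else F [::].

Lemma mean_ext n (F G : seq bool -> R) :
  (forall v, size v = n -> F v = G v) -> mean n F = mean n G.
Proof.
elim: n F G => [|n IH] F G FG /=; first exact: FG.
by congr ((_ + _) / 2); apply: IH => v vn; apply: FG; rewrite /= vn.
Qed.

Lemma mean_le n (F G : seq bool -> R) :
  (forall v, size v = n -> F v <= G v) -> mean n F <= mean n G.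
Proof.
elim: n F G => [|n IH] F G FG /=; first exact: FG.
by rewrite ler_pM2r ?invr_gt0 // lerD // IH // => v vn; apply: FG; rewrite /= vn.
Qed.

Lemma meanD n (F G : seq bool -> R) : mean n (fun v => F v + G v) = mean n F + mean n G.
Proof. by elim: n F G => [//|n IH] F G /=; rewrite !IH; lra. Qed.

Lemma meanZ n c (F : seq bool -> R) : mean n (fun v => c * F v) = c * mean n F.
Proof. by elim: n F => [//|n IH] F /=; rewrite !IH; lra. Qed.

Lemma mean_cst n c : mean n (fun=> c) = c.
Proof. by elim: n => [//|n IH] /=; rewrite !IH; lra. Qed.

Lemma mean_norm n (F : seq bool -> R) : `|mean n F| <= mean n (fun v => `|F v|).
Proof.
rewrite ler_norml -mulN1r -meanZ; apply/andP; split.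
  by apply: mean_le => v _; rewrite mulN1r lerNl ler_normr lexx orbT.
by apply: mean_le => v _; exact: ler_norm.
Qed.

(** The first letter is drawn last: [v] stands for the part of the word that has
been drawn, to which a letter is added on the left. *)
Lemma meanS n (F : seq bool -> R) :
  mean n.+1 F = mean n (fun v => (F (true :: v) + F (false :: v)) / 2).
Proof. by rewrite /= -meanD mulrC -meanZ; apply: mean_ext => v _; rewrite mulrC. Qed.

(** What the letters [v] add to the height of the stack [s]: [true] pushes and
[false] pops, and a positive sign is turned into a negative one before it
disappears. *)
Fixpoint gain (v s : seq bool) : nat :=
  match v, s with
  | [::], _ => 0
  | true :: v', _ => (gain v' (true :: s)).+1
  | false :: v', [::] => (gain v' [:: true]).+1
  | false :: v', true :: s' => gain v' (false :: s')
  | false :: v', false :: s' => (gain v' s').+1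
  end.

Definition bit_letter (c : bool) : 'I_2 := if c then ord0 else ord_max.

(** At each step one of the two letters pushes and the other one pops; which one
does depends on the parity of the exponent and on the axis, but the average over
both does not. *)
Lemma mean_height n x (G : int -> R) :
  mean n (fun s => G (height (run x (map bit_letter s))))
  = mean n (fun v => G (height x + (gain v (stack x))%:Z)).
Proof.
elim: n x => [|n IH] x; first by rewrite /= addr0.
rewrite /= !IH.
case: x => a [|e s] j; rewrite /push /= /height /=.
  by congr ((_ + _) / 2); apply: mean_ext => v _; congr G; lia.
have : (twist j ord0 = a /\ twist j ord_max = other a) \/
       (twist j ord0 = other a /\ twist j ord_max = a).
  by rewrite /twist; case: (odd j); have [->|->] := ordP a; [right|left|left|right].
case=> -[-> ->]; rewrite other_neq eqxx.
  congr ((_ + _) / 2); apply: mean_ext => v _; congr G.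
    by rewrite /=; lia.
  by case: e; rewrite /=; lia.
rewrite addrC; congr ((_ + _) / 2); apply: mean_ext => v _; congr G.
  by rewrite /=; lia.
by case: e; rewrite /=; lia.
Qed.

(** The number of pops by which [v] acts on what lies below it: a push on the left
of [v] absorbs two of them. *)
Fixpoint defect (v : seq bool) : nat :=
  match v with
  | [::] => 0
  | true :: v' => (defect v').-2
  | false :: v' => (defect v').+1
  end.

(** A push earns one, and one more if the sign that it creates is later removed. *)
Fixpoint score (v : seq bool) : nat :=
  match v with
  | [::] => 0
  | true :: v' => score v' + (if (defect v' <= 1)%N then 1 else 2)
  | false :: v' => score v'
  end.

(** Any word acts on stacks as a constant gain followed by pops, so that the
gain is within [defect v] of a quantity that is additive along the chain. *)
Lemma gain_score v s : gain v s = (score v + gain (nseq (defect v) false) s)%N.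
Proof.
elim: v s => [|[] v IH] s //=; last by case: s => [|[] s]; rewrite IH ?addnS.
by rewrite IH; case: (defect v) => [|[|d]] /=; lia.
Qed.

Lemma gain_pops d s : (gain (nseq d false) s <= d)%N.
Proof.
elim: d s => [|d IH] [|[] s] //=; rewrite ?ltnS ?IH //.
exact: leqW.
Qed.

Lemma gain_bounds v s : (score v <= gain v s <= score v + defect v)%N.
Proof. by rewrite gain_score leq_addr leq_add2l gain_pops. Qed.

End Walk.

(** * The normal distribution function *)

Section Gauss.
Variable R : realType.
Local Notation mu := (@lebesgue_measure R).

Definition gauss (y : R) : R := (Num.sqrt (2 * pi))^-1 * expR (- y ^+ 2 / 2).

Lemma gaussE : gauss = normal_pdf 0 1.
Proof.
apply/funext => y; rewrite normal_pdfE ?oner_neq0 // /gauss /normal_peak /normal_fun.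
by rewrite subr0 !expr1n mul1r mulr_natl.
Qed.

Definition Phi (x : R) : R := \int[mu]_(t in `]-oo, x]) gauss t.

Lemma gauss_integrable (A : set R) : measurable A -> mu.-integrable A (EFin \o gauss).
Proof.
move=> mA; apply: (@integrableS _ _ _ mu setT) => //.
by rewrite gaussE; exact: integrable_normal_pdf.
Qed.

Lemma continuous_gauss : continuous gauss.
Proof. by rewrite gaussE; apply: continuous_normal_pdf; rewrite oner_neq0. Qed.

Lemma is_derive_Phi (x : R) : is_derive x 1 Phi (gauss x).
Proof.
have x1 : x < x + 1 by rewrite ltrDl.
have [|d e] := @continuous_FTC1 R gauss (BInfty R true) x _ x1
  (gauss_integrable (measurable_itv _)) _ (@continuous_gauss x).
  by rewrite ltNyr.
by apply: DeriveDef; [exact: d|rewrite -derive1E; exact: e].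
Qed.

Lemma Phi_sub a b : a <= b ->
  Phi b - Phi a = (Num.sqrt (2 * pi))^-1 * \int[mu]_(t in `[a, b]) expR (- t ^+ 2 / 2).
Proof.
move=> ab; rewrite /Phi Rintegral_itvB ?bnd_simp //; last first.
  exact: (gauss_integrable (measurable_itv _)).
rewrite Rintegral_itv_obnd_cbnd; last exact: (gauss_integrable (measurable_itv _)).
rewrite /gauss RintegralZl //.
have -> : (EFin \o (fun x => expR (- x ^+ 2 / 2)) : R -> \bar R)
    = (fun x => (Num.sqrt (2 * pi))%:E * (EFin \o gauss) x)%E.
  apply/funext => x; rewrite /gauss /= -EFinM mulrA divff ?mul1r //.
  by rewrite gt_eqF // sqrtr_gt0 mulr_gt0 // pi_gt0.
by apply: integrableZl; [|exact: gauss_integrable].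
Qed.

Lemma Phi_prob x : (Phi x)%:E = normal_prob 0 1 `]-oo, x].
Proof.
rewrite /Phi /Rintegral gaussE fineK //.
exact: (fin_num_measure (normal_prob (0 : R) 1)).
Qed.

(** The identity, seen as a standard normal random variable: its cumulative
distribution function is [Phi]. *)
Definition normal_id : {RV (normal_prob (0 : R) 1) >-> R} :=
  HB.pack (idfun : measurableTypeR R -> R)
    (@isMeasurableFun.Build _ _ (measurableTypeR R) R
      (idfun : measurableTypeR R -> R) (@measurable_id _ _ setT)).

Lemma Phi_cdf x : (Phi x)%:E = cdf normal_id x.
Proof. by rewrite Phi_prob. Qed.

Lemma Phi_ge0 x : 0 <= Phi x.
Proof. by rewrite -lee_fin Phi_cdf cdf_ge0. Qed.

Lemma Phi_le1 x : Phi x <= 1.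
Proof. by rewrite -lee_fin Phi_cdf cdf_le1. Qed.

Lemma Phi_homo : {homo Phi : x y / x <= y}.
Proof. by move=> x y xy; rewrite -lee_fin !Phi_cdf cdf_nondecreasing. Qed.

Lemma Phi_tails (e : R) : 0 < e -> exists M, forall x, M <= x ->
  1 - Phi x + Phi (- x) <= e.
Proof.
move=> e0.
have PhiE : Phi = fine \o cdf normal_id.
  by apply/funext => x; rewrite -[RHS]/(fine (cdf normal_id x)) -Phi_cdf.
have cy : Phi x @[x --> +oo] --> (1 : R).
  by rewrite PhiE; apply: fine_cvg; exact: cvg_cdfy1.
have cNy : Phi x @[x --> -oo] --> (0 : R).
  by rewrite PhiE; apply: fine_cvg; exact: cvg_cdfNy0.
have e20 : 0 < e / 2 by rewrite divr_gt0.
have /cvgrPdist_le/(_ _ e20)[B [_ HB]] := cy.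
have /cvgrPdist_le/(_ _ e20)[A [_ HA]] := cNy.
exists (Num.max (1 - A) (B + 1)) => x; rewrite ge_max => /andP[xA xB].
have /HA : - x < A by lra.
have /HB : B < x by lra.
by move=> /ler_normlP[] ? ? /ler_normlP[] ? ?; lra.
Qed.

Lemma gauss_ge0 x : 0 <= gauss x.
Proof. by rewrite mulr_ge0 ?invr_ge0 ?sqrtr_ge0 ?expR_ge0. Qed.

(** As [pi] exceeds 2, the peak of the density is below 1. *)
Lemma gauss_bound x : gauss x <= expR (- x ^+ 2 / 2).
Proof.
rewrite ler_piMl ?expR_ge0 // invf_le1 ?sqrtr_gt0 ?mulr_gt0 ?pi_gt0 //.
rewrite -[leLHS]sqrtr1 ler_sqrt; last by rewrite mulr_ge0 ?pi_ge0.
by have := pi_ge2 R; lra.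
Qed.

Lemma gauss_le1 x : gauss x <= 1.
Proof.
apply: le_trans (gauss_bound x) _; rewrite -expR0 ler_expR.
by rewrite mulNr oppr_le0 divr_ge0 ?sqr_ge0.
Qed.

Lemma Phi_lipschitz x y : `|Phi x - Phi y| <= `|x - y|.
Proof.
wlog xy : x y / y <= x => [H|].
  by have [/H //|/ltW/H] := leP y x; rewrite distrC [X in _ <= X]distrC.
have [z zi ->] := MVT_segment xy (fun z _ => is_derive_Phi z)
  (derivable_within_continuous (fun z _ => @ex_derive _ _ _ _ _ _ _ (is_derive_Phi z))).
by rewrite normrM ler_piMl // ger0_norm ?gauss_ge0 ?gauss_le1.
Qed.

(** The fourth power is dominated by the square of [expR (- x ^+ 2 / 4)], and lower
powers by the fourth one. *)
Lemma gauss_moment k x : (k <= 3)%N -> `|x| ^+ k * gauss x <= 17.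
Proof.
move=> k3; have g1 := gauss_le1 x; have g0 := gauss_ge0 x.
have g4 : x ^+ 4 * gauss x <= 16.
  pose t := x ^+ 2 / 4; have t0 : 0 <= t by rewrite divr_ge0 ?sqr_ge0.
  have e1 : 0 < expR (- t) by exact: expR_gt0.
  have h : expR (- t) * t <= 1.
    rewrite expRN ler_pdivrMl ?expR_gt0 // mulr1.
    by apply: le_trans (expR_ge1Dx t); lra.
  have ge : gauss x <= expR (- t) * expR (- t).
    apply: le_trans (gauss_bound x) _; rewrite -expRD ler_expR /t; lra.
  have -> : x ^+ 4 = 16 * (t * t) by rewrite /t; field.
  apply: (@le_trans _ _ (16 * ((expR (- t) * t) * (expR (- t) * t)))).
    have -> : expR (- t) * t * (expR (- t) * t) = t * t * (expR (- t) * expR (- t)).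
      by ring.
    by rewrite -mulrA ler_pM2l // ler_wpM2l // mulr_ge0.
  by rewrite -[leRHS]mulr1 ler_pM2l // mulr_ile1 // mulr_ge0 // ltW.
suff : `|x| ^+ k <= 1 + x ^+ 4.
  by move=> /(ler_wpM2r g0)/le_trans; apply; rewrite mulrDl; lra.
have -> : x ^+ 4 = `|x| ^+ 4 by rewrite -normrX ger0_norm // exprn_even_ge0.
have [x1|/ltW x1] := leP `|x| 1.
  by rewrite -[leLHS]addr0 lerD ?exprn_ge0 // exprn_ile1.
by rewrite -[leLHS]add0r lerD ?ler01 // ler_weXn2l // (leq_trans k3).
Qed.

End Gauss.

(** * Derivatives of the heat kernel *)

Section HeatKernel.
Variable R : realType.

Lemma mean_value (f f' : R -> R) (a b : R) : a <= b ->
  (forall x, a <= x <= b -> is_derive x 1 f (f' x)) ->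
  exists2 c, a <= c <= b & f b - f a = f' c * (b - a).
Proof.
move=> ab df.
have [||c] := @MVT_segment R f f' a b ab.
- by move=> x; rewrite in_itv /= => /andP[/ltW ? /ltW ?]; apply: df; apply/andP.
- apply: derivable_within_continuous => x; rewrite in_itv /= => xab.
  by have := df x xab => ?; exact: ex_derive.
by rewrite in_itv /= => cab fE; exists c.
Qed.

Lemma derive_lipschitz (f f' : R -> R) (a b L : R) :
  (forall x, a <= x <= b -> is_derive x 1 f (f' x)) ->
  (forall x, a <= x <= b -> `|f' x| <= L) ->
  forall x y, a <= x <= b -> a <= y <= b -> `|f x - f y| <= L * `|x - y|.
Proof.
move=> df bf x y; wlog yx : x y / y <= x => [H xab yab|xab yab].
  have [yx|/ltW xy] := leP y x; first exact: H.
  by rewrite distrC [X in _ * X]distrC; exact: H.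
have dfyx c : y <= c <= x -> is_derive c 1 f (f' c).
  by move=> /andP[? ?]; apply: df; move: xab yab; lra.
have [c cyx ->] := mean_value yx dfyx.
rewrite normrM ler_wpM2r //; apply: bf.
by move: cyx xab yab; lra.
Qed.

(** Taylor's formula with the second derivative merely Lipschitz: two applications
of the mean value theorem, to the function of [h] and then to [g]. *)
Lemma second_difference (f g k : R -> R) (L z h : R) :
  (forall x : R, is_derive x 1 f (g x)) ->
  (forall x : R, is_derive x 1 g (k x)) ->
  (forall x y, `|k x - k y| <= L * `|x - y|) ->
  `|f (z + h) + f (z - h) - 2 * f z - h ^+ 2 * k z| <= 2 * L * `|h| ^+ 3.
Proof.
move=> df dg lk; wlog h0 : h / 0 <= h => [H|].
  have [/H //|/ltW h0] := leP 0 h.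
  have := H (- h); rewrite oppr_ge0 sqrrN normrN opprK [f (z - h) + _]addrC.
  by apply.
(* the derivative of [p] is a first difference of [g], minus its linear part *)
pose p t := f (z + t) + f (z - t) - t ^+ 2 * k z.
have dp (t : R) : is_derive t 1 p (g (z + t) - g (z - t) - 2 * t * k z).
  have s1 : is_derive t 1 (cst z + id : R -> R) 1.
    by apply: is_derive_eq; exact: add0r.
  have s2 : is_derive t 1 (cst z - id : R -> R) (-1).
    by apply: is_derive_eq; exact: add0r.
  have d1 := @is_derive1_comp R f (cst z + id) t _ _ (df (z + t)) s1.
  have d2 := @is_derive1_comp R f (cst z - id) t _ _ (df (z - t)) s2.
  have -> : p = (f \o (cst z + id)) + (f \o (cst z - id)) - id ^+ 2 * cst (k z) by [].
  by apply: is_derive_eq; rewrite /GRing.scale /= expr1; ring.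
have [c /andP[c0 ch] pE] := @mean_value p _ 0 h h0 (fun t _ => dp t).
have zc : z - c <= z + c by lra.
have [xi /andP[xi1 xi2] gE] := @mean_value g k _ _ zc (fun t _ => dg t).
have -> : f (z + h) + f (z - h) - 2 * f z - h ^+ 2 * k z = p h - p 0.
  by rewrite /p !addr0 subr0 expr0n /=; ring.
rewrite pE gE.
have -> : (k xi * (z + c - (z - c)) - 2 * c * k z) * (h - 0) = 2 * c * h * (k xi - k z).
  by ring.
have xiz : `|xi - z| <= h by rewrite ler_norml; lra.
have L0 : 0 <= L.
  have := lk 1 0; rewrite subr0 normr1 mulr1; exact: le_trans.
rewrite normrM ger0_norm; last by rewrite !mulr_ge0.
rewrite (ger0_norm h0).
apply: (@le_trans _ _ (2 * c * h * (L * h))).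
  rewrite ler_wpM2l ?mulr_ge0 //; apply: le_trans (lk _ _) _.
  by rewrite ler_wpM2l.
have -> : 2 * L * h ^+ 3 = 2 * h * h * (L * h) by ring.
by rewrite ler_wpM2r ?mulr_ge0 // ler_wpM2r // ler_wpM2l.
Qed.

Definition rsqrt (tau : R) : R := (Num.sqrt tau)^-1.

(** The probability that a centred normal variable of variance [tau] is at most
[z]; it solves the heat equation, see [is_derive_heat_tau]. *)
Definition heat (tau z : R) : R := Phi (z * rsqrt tau).
Definition heat_z (tau z : R) : R := gauss (z * rsqrt tau) * rsqrt tau.
Definition heat_zz (tau z : R) : R :=
  - rsqrt tau ^+ 2 * (z * rsqrt tau * gauss (z * rsqrt tau)).

Lemma is_derive_gauss (y : R) : is_derive y 1 (@gauss R) (- y * gauss y).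
Proof.
have d : is_derive y 1 (- id ^+ 2 * cst 2^-1 : R -> R) (- y).
  by apply: is_derive_eq; rewrite /GRing.scale /= expr1; field.
have dc := @is_derive1_comp R expR (- id ^+ 2 * cst 2^-1) y _ _ (is_derive_expR _) d.
have gE : @gauss R = cst (Num.sqrt (2 * pi))^-1 * (expR \o (- id ^+ 2 * cst 2^-1)).
  by [].
rewrite {1}gE.
apply: is_derive_eq; rewrite /gauss /GRing.scale /=; ring.
Qed.

Lemma is_derive_ygauss (y : R) :
  is_derive y 1 (fun y : R => y * gauss y) ((1 - y ^+ 2) * gauss y).
Proof.
have := is_derive_gauss y => d.
have -> : (fun y : R => y * gauss y) = id * @gauss R by [].
by apply: is_derive_eq; rewrite /GRing.scale /=; ring.
Qed.

Lemma is_derive_rsqrt (tau : R) : 0 < tau ->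
  is_derive tau 1 rsqrt (- rsqrt tau ^+ 3 / 2).
Proof.
move=> t0; have s0 : Num.sqrt tau != 0 by rewrite gt_eqF // sqrtr_gt0.
have d := is_derive1_sqrt t0.
have := is_deriveV s0 d => dv; apply: is_derive_eq.
by rewrite /rsqrt /GRing.scale /=; field.
Qed.

Lemma is_derive_scale (c z : R) : is_derive z 1 (fun z : R => z * c) c.
Proof.
have -> : (fun z : R => z * c) = id * cst c by [].
by apply: is_derive_eq; rewrite /GRing.scale /=; ring.
Qed.

Lemma is_derive_heat tau (z : R) : is_derive z 1 (heat tau) (heat_z tau z).
Proof.
exact: (is_derive1_comp (is_derive_Phi _) (is_derive_scale (rsqrt tau) z)).
Qed.

Lemma is_derive_heat_z tau (z : R) : is_derive z 1 (heat_z tau) (heat_zz tau z).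
Proof.
have d := is_derive1_comp (is_derive_gauss _) (is_derive_scale (rsqrt tau) z).
have -> : heat_z tau = (@gauss R \o (fun z => z * rsqrt tau)) * cst (rsqrt tau) by [].
by apply: is_derive_eq; rewrite /heat_zz /GRing.scale /=; ring.
Qed.

Lemma is_derive_heat_zz tau (z : R) : is_derive z 1 (heat_zz tau)
  (- rsqrt tau ^+ 3 * ((1 - (z * rsqrt tau) ^+ 2) * gauss (z * rsqrt tau))).
Proof.
have d := is_derive1_comp (is_derive_ygauss _) (is_derive_scale (rsqrt tau) z).
have -> : heat_zz tau = cst (- rsqrt tau ^+ 2)
  * ((fun y => y * @gauss R y) \o (fun z => z * rsqrt tau)) by [].
by apply: is_derive_eq; rewrite /GRing.scale /=; ring.
Qed.

Lemma is_derive_arg (z tau : R) : 0 < tau ->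
  is_derive tau 1 (fun tau => z * rsqrt tau) (- z * rsqrt tau ^+ 3 / 2).
Proof.
move=> /is_derive_rsqrt d.
have -> : (fun tau => z * rsqrt tau) = cst z * rsqrt by [].
by apply: is_derive_eq; rewrite /GRing.scale /=; ring.
Qed.

Lemma is_derive_heat_tau (z tau : R) : 0 < tau ->
  is_derive tau 1 (heat^~ z) (heat_zz tau z / 2).
Proof.
move=> t0; have d := is_derive1_comp (is_derive_Phi _) (is_derive_arg z t0).
apply: (is_derive_eq d).
by rewrite /heat_zz; ring.
Qed.

Lemma is_derive_heat_zz_tau (z tau : R) : 0 < tau ->
  let y := z * rsqrt tau in
  is_derive tau 1 (heat_zz^~ z)
    (rsqrt tau ^+ 4 * (y * gauss y + y * ((1 - y ^+ 2) * gauss y) / 2)).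
Proof.
move=> t0 y; have d := is_derive1_comp (is_derive_ygauss _) (is_derive_arg z t0).
have d2 := is_derive_rsqrt t0.
have -> : heat_zz^~ z = (- rsqrt ^+ 2)
  * ((fun y => y * @gauss R y) \o (fun tau => z * rsqrt tau)) by [].
apply: is_derive_eq; rewrite /GRing.scale /= -/y expr1.
by rewrite -[(- rsqrt ^+ 2) tau]/(- (rsqrt tau ^+ 2)) /y; field.
Qed.

Lemma rsqrt_le (e tau : R) : 0 < e -> e <= tau -> 0 <= rsqrt tau <= rsqrt e.
Proof.
move=> e0 et; have t0 := lt_le_trans e0 et.
rewrite invr_ge0 sqrtr_ge0 /= lef_pV2 ?posrE ?sqrtr_gt0 //.
by rewrite ler_sqrt // ltW.
Qed.

Lemma moment_bound (y : R) :
  [/\ `|y * gauss y| <= 17, `|(1 - y ^+ 2) * gauss y| <= 34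
    & `|y * ((1 - y ^+ 2) * gauss y)| <= 34].
Proof.
have g0 := gauss_ge0 y; have m := @gauss_moment R _ y _.
have m0 := m 0%N isT; have m1 := m 1%N isT; have m2 := m 2%N isT; have m3 := m 3%N isT.
rewrite expr0 mul1r in m0; rewrite expr1 in m1.
have n1 : `|1 - y ^+ 2| <= 1 + `|y| ^+ 2.
  by rewrite -normrX; apply: le_trans (ler_normB _ _) _; rewrite normr1.
clear m; move: (gauss y) g0 m0 m1 m2 m3 => g g0 m0 m1 m2 m3.
have ng a : `|a * g| = `|a| * g by rewrite normrM (ger0_norm g0).
have n2 : `|1 - y ^+ 2| * g <= 34.
  by apply: le_trans (ler_wpM2r g0 n1) _; rewrite mulrDl mul1r; lra.
split; rewrite ?mulrA ng // normrM.
apply: (@le_trans _ _ (`|y| * (1 + `|y| ^+ 2) * g)).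
  by rewrite ler_wpM2r // ler_wpM2l.
have -> : `|y| * (1 + `|y| ^+ 2) * g = `|y| * g + `|y| ^+ 3 * g.
  by ring.
by lra.
Qed.

(** The regularity that the martingale argument uses.  All derivatives are a
power of [rsqrt tau], bounded away from [tau = 0], times a moment of the normal
density. *)
Lemma heat_bounds (e : R) : 0 < e -> exists2 L : R, 0 <= L &
  [/\ forall tau z, e <= tau -> `|heat_zz tau z| <= L,
      forall tau z z', e <= tau -> `|heat_zz tau z - heat_zz tau z'| <= L * `|z - z'|,
      forall tau tau' z, e <= tau -> e <= tau' ->
        `|heat_zz tau z - heat_zz tau' z| <= L * `|tau - tau'|,
      forall tau z h, e <= tau ->
        `|heat tau (z + h) + heat tau (z - h) - 2 * heat tau z - h ^+ 2 * heat_zz tau z|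
          <= L * `|h| ^+ 3
    & forall tau tau' z, e <= tau -> e <= tau' ->
        `|heat tau' z - heat tau z - (tau' - tau) / 2 * heat_zz tau' z|
          <= L * (tau' - tau) ^+ 2].
Proof.
move=> e0; pose M := 1 + rsqrt e.
have s0 : 0 <= rsqrt e by have := rsqrt_le e0 (lexx e); lra.
have M1 : 1 <= M by rewrite /M; lra.
have rM tau : e <= tau -> 0 <= rsqrt tau <= M.
  by move=> /(rsqrt_le e0); rewrite /M; lra.
have rX tau k : e <= tau -> (k <= 4)%N -> 0 <= rsqrt tau ^+ k <= M ^+ 4.
  move=> /rM/andP[r0 r1] k4; rewrite exprn_ge0 //=.
  apply: (@le_trans _ _ (M ^+ k)); first by rewrite lerXn2r ?nnegrE //; lra.
  by rewrite ler_weXn2l.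
have M40 : 0 <= M ^+ 4 by rewrite exprn_ge0 //; lra.
have prod_le (a b c d : R) : 0 <= a <= c -> `|b| <= d -> `|a * b| <= c * d.
  by move=> /andP[a0 ac] bd; rewrite normrM (ger0_norm a0) ler_pM.
have B1 tau z : e <= tau -> `|heat_zz tau z| <= M ^+ 4 * 17.
  move=> et; rewrite /heat_zz mulNr normrN; apply: prod_le; first exact: rX.
  by have [] := moment_bound (z * rsqrt tau).
have B2 tau z : e <= tau ->
    `|- rsqrt tau ^+ 3 * ((1 - (z * rsqrt tau) ^+ 2) * gauss (z * rsqrt tau))|
    <= M ^+ 4 * 34.
  move=> et; rewrite mulNr normrN; apply: prod_le; first exact: rX.
  by have [] := moment_bound (z * rsqrt tau).
have B3 tau z : e <= tau -> let y := z * rsqrt tau in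
    `|rsqrt tau ^+ 4 * (y * gauss y + y * ((1 - y ^+ 2) * gauss y) / 2)| <= M ^+ 4 * 34.
  move=> et /=; set y := z * rsqrt tau; apply: prod_le; first exact: rX.
  have [h1 _ h3] := moment_bound y.
  apply: le_trans (ler_normD _ _) _.
  by rewrite [X in _ + X <= _]normrM [`|2^-1|]ger0_norm //; lra.
have lipz tau z z' : e <= tau ->
    `|heat_zz tau z - heat_zz tau z'| <= M ^+ 4 * 34 * `|z - z'|.
  move=> et; apply: (derive_lipschitz (a := Num.min z z') (b := Num.max z z')
    (fun x _ => is_derive_heat_zz tau x) (fun x _ => B2 tau x et)).
    by rewrite ge_min lexx le_max lexx.
  by rewrite ge_min lexx orbT le_max lexx orbT.
have lipt tau tau' z : e <= tau -> e <= tau' ->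
    `|heat_zz tau z - heat_zz tau' z| <= M ^+ 4 * 34 * `|tau - tau'|.
  move=> et et'.
  have dz x : e <= x <= Num.max tau tau' -> _ :=
    fun h => @is_derive_heat_zz_tau z x (lt_le_trans e0 (proj1 (andP h))).
  apply: (derive_lipschitz (f := heat_zz^~ z) dz).
  - by move=> x /andP[ex _]; exact: B3.
  - by rewrite et le_max lexx.
  - by rewrite et' le_max lexx orbT.
exists (M ^+ 4 * 100); first by rewrite mulr_ge0.
split.
- by move=> tau z et; apply: le_trans (B1 tau z et) _; lra.
- move=> tau z z' et; apply: le_trans (lipz tau z z' et) _.
  by rewrite ler_wpM2r //; lra.
- move=> tau tau' z et et'; apply: le_trans (lipt tau tau' z et et') _.
  by rewrite ler_wpM2r //; lra.
- move=> tau z h et.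
  have := second_difference z h (is_derive_heat tau) (is_derive_heat_z tau)
    (fun x y => lipz tau x y et).
  by move=> /le_trans; apply; rewrite ler_wpM2r ?exprn_ge0 //; lra.
move=> tau tau' z et et'.
wlog tt : tau tau' et et' / tau <= tau' => [H|].
  have [/H|/ltW t't] := leP tau tau'; first exact.
  have [c /andP[c1 c2] hE] := mean_value t't
    (fun x h => is_derive_heat_tau z (lt_le_trans e0 (le_trans et' (proj1 (andP h))))).
  have -> : heat tau' z - heat tau z - (tau' - tau) / 2 * heat_zz tau' z
     = (tau - tau') / 2 * (heat_zz tau' z - heat_zz c z).
    by rewrite -[heat tau' z - _]opprB hE; ring.
  have ec : e <= c by exact: le_trans et' c1.
  rewrite normrM; have := lipt tau' c z et' ec.
  have -> : `|tau' - c| = c - tau' by rewrite ler0_norm; lra.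
  rewrite [`|(tau - tau') / 2|]ger0_norm; last by lra.
  move=> h; apply: (@le_trans _ _ ((tau - tau') / 2 * (M ^+ 4 * 34 * (tau - tau')))).
    rewrite ler_wpM2l //; first by lra.
    by apply: le_trans h _; rewrite ler_wpM2l ?mulr_ge0 //; lra.
  have -> : (tau - tau') / 2 * (M ^+ 4 * 34 * (tau - tau'))
    = M ^+ 4 * 17 * (tau' - tau) ^+ 2 by field.
  by rewrite ler_wpM2r ?sqr_ge0 //; lra.
have [c /andP[c1 c2] hE] := mean_value tt
  (fun x h => is_derive_heat_tau z (lt_le_trans e0 (le_trans et (proj1 (andP h))))).
have -> : heat tau' z - heat tau z - (tau' - tau) / 2 * heat_zz tau' z
   = (tau' - tau) / 2 * (heat_zz c z - heat_zz tau' z) by rewrite hE; ring.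
have ec : e <= c by exact: le_trans et c1.
rewrite normrM; have := lipt c tau' z ec et'.
have -> : `|c - tau'| = tau' - c by rewrite ler0_norm; lra.
rewrite [`|(tau' - tau) / 2|]ger0_norm; last by lra.
move=> h; apply: (@le_trans _ _ ((tau' - tau) / 2 * (M ^+ 4 * 34 * (tau' - tau)))).
  rewrite ler_wpM2l //; first by lra.
  by apply: le_trans h _; rewrite ler_wpM2l ?mulr_ge0 //; lra.
have -> : (tau' - tau) / 2 * (M ^+ 4 * 34 * (tau' - tau))
  = M ^+ 4 * 17 * (tau' - tau) ^+ 2 by field.
by rewrite ler_wpM2r ?sqr_ge0 //; lra.
Qed.

End HeatKernel.

(** * The defect chain and its Poisson equations *)

Section Chain.
Variable R : realType.

(** The inverse of the golden ratio; [(- rho) ^+ d] is harmonic for the defect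
chain, away from its boundary. *)
Definition rho : R := (Num.sqrt 5 - 1) / 2.

Lemma rho_sq : rho ^+ 2 = 1 - rho.
Proof.
have s5 : Num.sqrt 5 ^+ 2 = 5 :> R by rewrite sqr_sqrtr.
have -> : rho ^+ 2 = (Num.sqrt 5 ^+ 2 - 2 * Num.sqrt 5 + 1) / 4 by rewrite /rho; field.
by rewrite s5 /rho; field.
Qed.

Lemma rho_bounds : 3 / 5 <= rho <= 2 / 3.
Proof.
have s5 : Num.sqrt 5 ^+ 2 = 5 :> R by rewrite sqr_sqrtr.
have s0 : 0 <= Num.sqrt 5 :> R by exact: sqrtr_ge0.
by rewrite /rho; nra.
Qed.

Definition speed : R := 1 - rho / 2.
Definition variance : R := (3 * rho - 1) / 20.

Lemma variance_gt0 : 0 < variance.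
Proof. by rewrite /variance; have := rho_bounds; lra. Qed.

Definition osc (d : nat) : R := (- rho) ^+ d.

Lemma osc0 : osc 0 = 1. Proof. exact: expr0. Qed.

Lemma oscS d : osc d.+1 = - rho * osc d. Proof. exact: exprS. Qed.

Lemma osc_le1 d : `|osc d| <= 1.
Proof.
rewrite normrX normrN exprn_ile1 //; have := rho_bounds; rewrite ler_norml; lra.
Qed.

(** The score, compensated by the speed and by a solution of the Poisson equation
of the defect chain: [centered_true] and [centered_false] say that it is a
martingale. *)
Definition centered (v : seq bool) : R :=
  (score v)%:R - speed * (size v)%:R + rho * (defect v)%:R + rho ^+ 4 * osc (defect v).

Definition jump (d : nat) : R := 1 - 3 / 2 * rho + rho ^+ 3 * osc d.

Lemma jump_le1 d : `|jump d| <= 1.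
Proof.
have rb := rho_bounds; have := osc_le1 d; rewrite !ler_norml => /andP[p1 p2].
have r3 : 0 <= rho ^+ 3 <= 1 / 3.
  have -> : rho ^+ 3 = 2 * rho - 1 by ring: rho_sq.
  by lra.
by rewrite /jump; nra.
Qed.

Lemma centered_false v : centered (false :: v) = centered v - jump (defect v).
Proof.
rewrite /centered /jump /= oscS -!natr1 /speed.
by field: rho_sq.
Qed.

Lemma centered_true v : centered (true :: v) = centered v + jump (defect v).
Proof.
rewrite /centered /jump /= natrD -[(size v).+1%:R]natr1 /speed.
by case: (defect v) => [|[|d]] /=; rewrite ?(oscS, osc0) -?natr1; field: rho_sq.
Qed.

(** A Lyapunov function: away from 0 and 1, [(3 / 2) ^+ d] is multiplied on
average by [(3 / 2 + 4 / 9) / 2], which is [35 / 36]. *)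
Lemma mean_defect k : mean k (fun v => (defect v)%:R) <= 36 :> R.
Proof.
pose f v : R := (3 / 2) ^+ defect v.
have f0 v : 0 <= f v by rewrite exprn_ge0.
have fm : mean k f <= 18.
  elim: k => [|k IH]; first by rewrite /= /f expr0; lra.
  rewrite meanS; apply: (@le_trans _ _ (mean k (fun v => 35 / 36 * f v + 1 / 2))).
    apply: mean_le => v _; rewrite /f /=; case: (defect v) => [|[|d]] /=.
    - rewrite expr0 expr1; lra.
    - rewrite expr0 expr1 expr2; lra.
    - have h : 0 <= (3 / 2) ^+ d :> R by rewrite exprn_ge0.
      by rewrite !exprS; nra.
  by rewrite meanD meanZ mean_cst; lra.
apply: (@le_trans _ _ (mean k (fun v => 2 * f v))); last by rewrite meanZ; lra.
apply: mean_le => v _; rewrite /f; elim: (defect v) => [|d IH].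
  by rewrite expr0 mulr1.
have : 1 <= (3 / 2) ^+ d :> R by rewrite exprn_ege1 //; lra.
by rewrite exprS -[d.+1%:R]natr1; lra.
Qed.

(** The solution of the Poisson equation with right-hand side
[variance - jump ^+ 2], found by undetermined coefficients: the square of
[jump] is a combination of [1], [osc d] and [osc d ^+ 2], and the first two, being
harmonic away from the boundary, bring a factor [d]. *)
Definition corrector (d : nat) : R :=
  (33 - 54 * rho) / 5 * d%:R + (94 - 152 * rho) / 5 * d%:R * osc d
  + (217 * rho - 134) / 5 * osc d + (21 * rho - 13) * osc d ^+ 2.

Lemma corrector_poisson d :
  (corrector d.+1 + corrector d.-2) / 2 - corrector d = variance - jump d ^+ 2.
Proof.
rewrite /corrector /variance /jump.
case: d => [|[|d]] /=; rewrite ?(oscS, osc0).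
- by field: rho_sq.
- by field: rho_sq.
rewrite -[d.+3%:R]natr1 -[d.+2%:R]natr1 -[d.+1%:R]natr1.
by move: (osc d) (d%:R : R) => P D; field: rho_sq.
Qed.

Lemma corrector_bound d : `|corrector d| <= 100 * (1 + d%:R).
Proof.
have rb := rho_bounds; have := osc_le1 d; rewrite /corrector.
have d0 : 0 <= d%:R :> R by [].
move: (osc d) (d%:R : R) d0 => P D D0; rewrite !ler_norml => /andP[p1 p2].
have q : 0 <= P ^+ 2 <= 1 by rewrite sqr_ge0 /=; nra.
have dp : - D <= D * P <= D by nra.
have c1 : -1 <= (33 - 54 * rho) / 5 <= 1 by lra.
have c2 : -2 <= (94 - 152 * rho) / 5 <= 2 by lra.
have c3 : -10 <= (217 * rho - 134) / 5 <= 10 by lra.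
have c4 : -1 <= 21 * rho - 13 <= 1 by lra.
rewrite -[(94 - 152 * rho) / 5 * D * P]mulrA.
move: ((33 - 54 * rho) / 5) ((94 - 152 * rho) / 5) ((217 * rho - 134) / 5)
  (21 * rho - 13) (P ^+ 2) (D * P) c1 c2 c3 c4 q dp => a b c e Q DP c1 c2 c3 c4 q dp.
have t1 : - D <= a * D <= D by nra.
have t2 : - (2 * D) <= b * DP <= 2 * D by nra.
have t3 : -10 <= c * P <= 10 by nra.
have t4 : -1 <= e * Q <= 1 by nra.
by lra.
Qed.

End Chain.

(** * The central limit theorem for smooth test functions *)

Section SmoothCLT.
Variable R : realType.
Local Notation V := (variance R).

Lemma variance_bounds : 1 / 25 <= V <= 1.
Proof. by rewrite /variance; have := rho_bounds R; lra. Qed.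

(** The bound 5 on [eta] comes from [variance_bounds]: one over the square root of
the variance is at most 5. *)
Lemma variance_eta (eta : R) : 0 < eta <= 5 ->
  V ^+ 2 * eta <= 5 /\ V * eta ^+ 2 <= 5 * eta.
Proof.
move=> /andP[e0 e5]; have /andP[v0 v1] := variance_bounds.
have v2 : V ^+ 2 <= 1 by rewrite exprn_ile1 //; lra.
move: (V) v0 v1 v2 => v v0 v1 v2; split.
  by apply: le_trans (ler_wpM2r (ltW e0) v2) _; rewrite mul1r.
have q : v * eta <= 5 by nra.
by rewrite expr2 mulrA ler_wpM2r // ltW.
Qed.

Lemma correction_bound (eta x w y L : R) : 0 < eta <= 5 -> `|x| <= y -> `|w| <= L ->
  `|eta ^+ 2 / 2 * x * w| <= 5 / 2 * eta * y * L.
Proof.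
move=> /andP[e0 e5] xy wL; rewrite 2!normrM; apply: ler_pM => //.
apply: ler_pM => //; rewrite ger0_norm ?divr_ge0 ?sqr_ge0 // expr2.
by nra.
Qed.

Lemma heat_start (e eta c : R) : 0 <= e -> 0 <= eta ->
  `|heat (1 + e) (c - eta * rho R ^+ 4) - heat (1 + e) c| <= eta.
Proof.
move=> e0 eta0; apply: le_trans (Phi_lipschitz _ _) _; rewrite -mulrBl.
have -> : c - eta * rho R ^+ 4 - c = - (eta * rho R ^+ 4) by ring.
have rb := rho_bounds R.
have r4 : 0 <= rho R ^+ 4 by rewrite exprn_ge0 //; lra.
have r4' : rho R ^+ 4 <= 1 by rewrite exprn_ile1 //; lra.
have e1 : 1 <= 1 + e by rewrite lerDl.
have /andP[r0 r1] := rsqrt_le ltr01 e1.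
have {}r1 : rsqrt (1 + e) <= 1 by rewrite (le_trans r1) // /rsqrt sqrtr1 invr1.
rewrite mulNr normrN ger0_norm; last exact: (mulr_ge0 (mulr_ge0 eta0 r4) r0).
by rewrite -mulrA ler_piMr // mulr_ile1.
Qed.

(** The one-step errors of Lindeberg's method add up. *)
Lemma telescope_bound (G : nat -> seq bool -> R) (N : nat) (B : R) :
  (forall k, (k < N)%N -> mean k (fun v =>
     `|(G k.+1 (true :: v) + G k.+1 (false :: v)) / 2 - G k v|) <= B) ->
  `|mean N (G N) - G 0%N [::]| <= N%:R * B.
Proof.
elim: N => [|N IH] GB; first by rewrite /= subrr normr0 mul0r.
have -> : mean N.+1 (G N.+1) - G 0%N [::]
   = mean N (fun v => (G N.+1 (true :: v) + G N.+1 (false :: v)) / 2 - G N v)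
     + (mean N (G N) - G 0%N [::]).
  have -> : mean N (fun v => (G N.+1 (true :: v) + G N.+1 (false :: v)) / 2 - G N v)
    = mean N.+1 (G N.+1) - mean N (G N).
    rewrite meanS -[- mean N (G N)]mulN1r -meanZ -meanD.
    by apply: mean_ext => v _; rewrite mulN1r.
  by ring.
apply: le_trans (ler_normD _ _) _; rewrite -[N.+1%:R]natr1 mulrDl mul1r addrC.
apply: lerD; first by apply: IH => k kN; apply: GB; exact: ltnW.
by apply: le_trans (mean_norm _ _) _; exact: GB.
Qed.

(** The second-order terms in [eta] of one step: half the square of the jump from
the martingale, half the variance from the heat equation, and the difference of
correctors, which cancel by the Poisson equation.  What remains is of order
three. *)
Lemma step_error (L eta d j c0 c1 c2 hp hm h1 h0 wp wm w0 W : R) :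
  0 <= L -> 0 < eta <= 5 -> 0 <= d ->
  (c1 + c2) / 2 - c0 = V - j ^+ 2 ->
  `|c0| <= 200 * (1 + d) -> `|c1| <= 200 * (1 + d) -> `|c2| <= 200 * (1 + d) ->
  `|hp + hm - 2 * h1 - (eta * j) ^+ 2 * W| <= L * eta ^+ 3 ->
  `|h1 - h0 - - (V * eta ^+ 2) / 2 * W| <= 5 * L * eta ^+ 3 ->
  `|wm - W| <= L * eta -> `|wp - W| <= L * eta -> `|w0 - W| <= 5 * L * eta ->
  `|(hm + eta ^+ 2 / 2 * c1 * wm + (hp + eta ^+ 2 / 2 * c2 * wp)) / 2
    - (h0 + eta ^+ 2 / 2 * c0 * w0)| <= 1000 * (L * eta ^+ 3) * (1 + d).
Proof.
move=> L0 /andP[e0 e5] d0 poisson c0b c1b c2b Ab Bb a1b a2b bb.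
set A := hp + hm - _ - _ in Ab; set B := h1 - _ - _ in Bb.
set a1 := wm - W in a1b; set a2 := wp - W in a2b; set b := w0 - W in bb.
(* the factor of [W] is the defect in the Poisson equation, that is, zero *)
have -> : (hm + eta ^+ 2 / 2 * c1 * wm + (hp + eta ^+ 2 / 2 * c2 * wp)) / 2
    - (h0 + eta ^+ 2 / 2 * c0 * w0)
  = A / 2 + B + eta ^+ 2 / 4 * (c1 * a1 + c2 * a2) - eta ^+ 2 / 2 * (c0 * b)
    + eta ^+ 2 / 2 * W * ((c1 + c2) / 2 - c0 - (V - j ^+ 2)).
  by rewrite /A /B /a1 /a2 /b; field.
clearbody A B a1 a2 b.
rewrite poisson subrr mulr0 addr0.
have t1 : `|c1 * a1| <= 200 * (1 + d) * (L * eta) by rewrite normrM ler_pM.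
have t2 : `|c2 * a2| <= 200 * (1 + d) * (L * eta) by rewrite normrM ler_pM.
have t0 : `|c0 * b| <= 200 * (1 + d) * (5 * L * eta) by rewrite normrM ler_pM.
have q0 : 0 <= eta ^+ 2 by rewrite sqr_ge0.
have s12 : `|eta ^+ 2 / 4 * (c1 * a1 + c2 * a2)| <= 100 * (L * eta ^+ 3 * (1 + d)).
  rewrite normrM ger0_norm ?divr_ge0 //.
  apply: (@le_trans _ _ (eta ^+ 2 / 4 * (400 * (1 + d) * (L * eta)))).
    by rewrite ler_wpM2l ?divr_ge0 //; apply: le_trans (ler_normD _ _) _; lra.
  by rewrite le_eqVlt; apply/orP; left; apply/eqP; field.
have s0 : `|eta ^+ 2 / 2 * (c0 * b)| <= 500 * (L * eta ^+ 3 * (1 + d)).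
  rewrite normrM ger0_norm ?divr_ge0 //.
  apply: (@le_trans _ _ (eta ^+ 2 / 2 * (200 * (1 + d) * (5 * L * eta)))).
    by rewrite ler_wpM2l ?divr_ge0.
  by rewrite le_eqVlt; apply/orP; left; apply/eqP; field.
have X0 : 0 <= L * eta ^+ 3 by rewrite mulr_ge0 // exprn_ge0 // ltW.
have Xd : 0 <= L * eta ^+ 3 * d by rewrite mulr_ge0.
move: Ab Bb s12 s0; rewrite !ler_norml.
move: (eta ^+ 2 / 4 * _) (eta ^+ 2 / 2 * _) => u v.
have -> : 5 * L * eta ^+ 3 = 5 * (L * eta ^+ 3) by ring.
have -> : 1000 * (L * eta ^+ 3) * (1 + d) = 1000 * (L * eta ^+ 3 + L * eta ^+ 3 * d) by ring.
have -> : L * eta ^+ 3 * (1 + d) = L * eta ^+ 3 + L * eta ^+ 3 * d by ring.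
move: (L * eta ^+ 3) (L * eta ^+ 3 * d) X0 Xd => X Y X0 Y0.
by lra.
Qed.

Lemma corrector_bounds d :
  [/\ `|corrector R d| <= 200 * (1 + d%:R), `|corrector R d.-2| <= 200 * (1 + d%:R)
    & `|corrector R d.+1| <= 200 * (1 + d%:R)].
Proof.
have d0 : 0 <= d%:R :> R by [].
have d2 : d.-2%:R <= d%:R :> R by rewrite ler_nat (leq_trans (leq_pred _)) ?leq_pred.
have := corrector_bound R d; have := corrector_bound R d.-2.
have := corrector_bound R d.+1; rewrite -[d.+1%:R]natr1 => h1 h2 h3.
by split; [apply: le_trans h3 _|apply: le_trans h2 _|apply: le_trans h1 _]; lra.
Qed.

(** The heat kernel is followed for the remaining time along the martingale.  As the
variance of a step depends on the state, the second-order correction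
[corrector] is added; the expectation then moves by [O (eta ^+ 3)] in each of
the [O (eta ^- 2)] steps. *)
Lemma smooth_clt (e : R) : 0 < e -> exists2 C, 0 <= C &
  forall (N : nat) (eta c : R), 0 < eta <= 5 -> V * eta ^+ 2 * N%:R = 1 ->
  `|mean N (fun v => heat e (c - eta * centered R v)) - heat (1 + e) c| <= C * eta.
Proof.
move=> e0; have [L L0 [W_bound W_lipz W_lipt heat_second heat_time]] := heat_bounds e0.
exists (1000 * 1000 * L + 1); first by lra.
move=> N eta c eb scaling; have /andP[eta0 eta5] := eb.
have Le : 0 <= L * eta by rewrite mulr_ge0 // ltW.
have L3 : 0 <= L * eta ^+ 3 by rewrite mulr_ge0 // exprn_ge0 // ltW.
have Vb := variance_bounds; have q0 : 0 <= eta ^+ 2 by rewrite sqr_ge0.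
(* the variance that remains to be spent after [k] letters, plus the smoothing *)
pose tau (k : nat) := e + V * eta ^+ 2 * (N - k)%:R.
have [V_eta V_eta2] := variance_eta eb.
have Vq : 0 <= V * eta ^+ 2 by rewrite mulr_ge0 //; lra.
have tau_ge k : e <= tau k by rewrite /tau lerDl mulr_ge0.
pose z v := c - eta * centered R v.
pose G k v := heat (tau k) (z v)
  + eta ^+ 2 / 2 * corrector R (defect v) * heat_zz (tau k) (z v).
have cb d : `|corrector R d| <= 100 * (1 + d%:R) := corrector_bound R d.
have step k v : (k < N)%N ->
    `|(G k.+1 (true :: v) + G k.+1 (false :: v)) / 2 - G k v|
    <= 1000 * (L * eta ^+ 3) * (1 + (defect v)%:R).
  move=> kN; pose d := defect v; pose j := jump R d; pose W := heat_zz (tau k.+1) (z v).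
  have tauE : tau k.+1 - tau k = - (V * eta ^+ 2).
    rewrite /tau; have -> : (N - k)%N = (N - k.+1).+1 by rewrite subnS prednK ?subn_gt0.
    by rewrite -[(N - k.+1).+1%:R]natr1; ring.
  have zt : z (true :: v) = z v - eta * j by rewrite /z centered_true /j /d; ring.
  have zf : z (false :: v) = z v + eta * j by rewrite /z centered_false /j /d; ring.
  have hj : `|eta * j| <= eta.
    by rewrite normrM (ger0_norm (ltW eta0)) ler_piMr ?jump_le1 // ltW.
  have Lh : L * `|eta * j| <= L * eta by rewrite ler_wpM2l.
  have [c0b c1b c2b] := corrector_bounds d.
  rewrite /G zt zf /= -/d.
  apply: (@step_error L eta d%:R j _ _ _ _ _ (heat (tau k.+1) (z v)) _ _ _ _ W) => //.
  - by rewrite -corrector_poisson [corrector R d.-2 + _]addrC.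
  - apply: le_trans (heat_second _ _ _ (tau_ge _)) _.
    by rewrite ler_wpM2l // lerXn2r // nnegrE // ltW.
  - have := heat_time _ _ (z v) (tau_ge k) (tau_ge k.+1).
    rewrite tauE sqrrN => /le_trans; apply.
    have -> : 5 * L * eta ^+ 3 = L * (5 * eta ^+ 3) by ring.
    rewrite ler_wpM2l //.
    have -> : (V * eta ^+ 2) ^+ 2 = V ^+ 2 * eta * eta ^+ 3 by ring.
    by rewrite ler_wpM2r ?exprn_ge0 ?V_eta // ltW.
  - apply: le_trans (W_lipz _ _ _ (tau_ge _)) _.
    by rewrite addrAC subrr add0r normrN.
  - apply: le_trans (W_lipz _ _ _ (tau_ge _)) _.
    by rewrite addrAC subrr add0r.
  - apply: le_trans (W_lipt _ _ _ (tau_ge _) (tau_ge _)) _.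
    rewrite distrC tauE normrN ger0_norm //.
    have -> : 5 * L * eta = L * (5 * eta) by ring.
    by rewrite ler_wpM2l.
have md k : mean k (fun v => 1 + (defect v)%:R) <= 37 :> R.
  by rewrite meanD mean_cst; have := mean_defect R k; lra.
have tele : `|mean N (G N) - G 0%N [::]| <= N%:R * (1000 * (L * eta ^+ 3) * 37).
  apply: telescope_bound => k kN.
  apply: (@le_trans _ _ (mean k (fun v => 1000 * (L * eta ^+ 3) * (1 + (defect v)%:R)))).
    by apply: mean_le => v _; exact: step.
  by rewrite meanZ; apply: ler_wpM2l; [lra|exact: md].
have Nq : N%:R * eta ^+ 2 <= 25.
  have : N%:R * eta ^+ 2 * V = 1 by rewrite -[RHS]scaling; ring.
  have : 0 <= N%:R * eta ^+ 2 by rewrite mulr_ge0.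
  by nra.
have tele' : `|mean N (G N) - G 0%N [::]| <= 25 * (37 * 1000 * (L * eta)).
  apply: le_trans tele _.
  have -> : N%:R * (1000 * (L * eta ^+ 3) * 37)
    = N%:R * eta ^+ 2 * (37 * 1000 * (L * eta)) by ring.
  by apply: ler_wpM2r; [lra|exact: Nq].
have last_le : `|mean N (fun v => heat e (z v)) - mean N (G N)| <= 250 * (L * eta) * 37.
  have tN : tau N = e by rewrite /tau subnn mulr0 addr0.
  rewrite -[- mean N (G N)]mulN1r -meanZ -meanD.
  apply: le_trans (mean_norm _ _) _.
  apply: (@le_trans _ _ (mean N (fun v => 250 * (L * eta) * (1 + (defect v)%:R)))).
    apply: mean_le => v _; rewrite /G tN mulN1r opprD addrA subrr add0r normrN.
    have -> : 250 * (L * eta) * (1 + (defect v)%:R)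
      = 5 / 2 * eta * (100 * (1 + (defect v)%:R)) * L by field.
    by apply: correction_bound => //; exact: W_bound.
  by rewrite meanZ; apply: ler_wpM2l; [lra|exact: md].
have first_le : `|G 0%N [::] - heat (1 + e) c| <= 250 * (L * eta) + eta.
  have t0 : tau 0%N = 1 + e by rewrite /tau subn0 scaling addrC.
  rewrite /G t0 [_ + _ * _]addrC -addrA; apply: le_trans (ler_normD _ _) _.
  apply: lerD.
    have -> : 250 * (L * eta) = 5 / 2 * eta * 100 * L by field.
    apply: correction_bound => //; first by have := cb 0%N; rewrite addr0 mulr1.
    by apply: W_bound; lra.
  have -> : z [::] = c - eta * rho R ^+ 4 by rewrite /z /centered /= osc0; ring.
  by apply: heat_start; exact: ltW.
have -> : mean N (fun v => heat e (z v)) - heat (1 + e) c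
   = (mean N (fun v => heat e (z v)) - mean N (G N)) + (mean N (G N) - G 0%N [::])
     + (G 0%N [::] - heat (1 + e) c) by ring.
apply: le_trans (ler_normD _ _) _.
apply: (@le_trans _ _ ((250 * (L * eta) * 37 + 25 * (37 * 1000 * (L * eta)))
  + (250 * (L * eta) + eta))).
  apply: lerD; last exact: first_le.
  apply: le_trans (ler_normD _ _) _; apply: lerD; [exact: last_le|exact: tele'].
have -> : (1000 * 1000 * L + 1) * eta = 1000 * 1000 * (L * eta) + eta by ring.
by move: (L * eta) Le => x x0; lra.
Qed.

End SmoothCLT.

(** * From smooth test functions to intervals *)

Section LetterCLT.
Variable R : realType.
Local Notation V := (variance R).

Definition word_height (s : seq bool) : int :=
  height (run (Normal ord0 [::] 0) (map bit_letter s)).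

Lemma heat_lipschitz (e x y : R) :
  `|heat e x - heat e y| <= rsqrt e * `|x - y|.
Proof.
apply: le_trans (Phi_lipschitz _ _) _; rewrite -mulrBl normrM mulrC.
by rewrite (ger0_norm (_ : 0 <= rsqrt e)) // invr_ge0 sqrtr_ge0.
Qed.

Lemma gain_centered v :
  `|(gain v [::])%:R - speed R * (size v)%:R - centered R v|
  <= 2 * (1 + (defect v)%:R).
Proof.
have /andP[] := gain_bounds v [::]; rewrite -!(ler_nat R) natrD /centered /=.
have rb := rho_bounds R; have := osc_le1 R (defect v).
have D0 : 0 <= (defect v)%:R :> R by [].
have r4 : 0 <= rho R ^+ 4 by rewrite exprn_ge0 //; lra.
have r4' : rho R ^+ 4 <= 1 by rewrite exprn_ile1 //; lra.
move: (gain v [::])%:R (score v)%:R (defect v)%:R (osc R (defect v)) (speed R * _)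
  (rho R ^+ 4) D0 r4 r4' => g s d p m q d0 q0 q1; rewrite !ler_norml => /andP[p0 p1] g0 g1.
have qp : -1 <= q * p <= 1 by nra.
have rd : 0 <= rho R * d <= d by nra.
by lra.
Qed.

(** The height differs from the martingale by a multiple of the defect, whose
mean is bounded. *)
Lemma height_clt (e : R) : 0 < e -> exists2 C : R, 0 <= C &
  forall (N : nat) (eta c : R), 0 < eta <= 5 -> V * eta ^+ 2 * N%:R = 1 ->
  `|mean N (fun s => heat e (c - eta * ((word_height s)%:~R - speed R * N%:R)))
    - heat (1 + e) c| <= C * eta.
Proof.
move=> e0; have [C C0 smooth] := smooth_clt e0.
have s0 : 0 <= rsqrt e by rewrite invr_ge0 sqrtr_ge0.
exists (C + rsqrt e * 74) => [|N eta c eb scaling].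
  by rewrite addr_ge0 // mulr_ge0.
rewrite /word_height (mean_height N _
  (fun h => heat e (c - eta * (h%:~R - speed R * N%:R)))).
set F := fun v => heat e _; have /andP[eta0 _] := eb.
have -> : mean N F - heat (1 + e) c
  = (mean N F - mean N (fun v => heat e (c - eta * centered R v)))
    + (mean N (fun v => heat e (c - eta * centered R v)) - heat (1 + e) c) by ring.
rewrite addrC mulrDl; apply: le_trans (ler_normD _ _) _.
apply: lerD; first exact: smooth.
rewrite -[- mean N _]mulN1r -meanZ -meanD; apply: le_trans (mean_norm _ _) _.
apply: (@le_trans _ _ (mean N (fun v => 2 * rsqrt e * eta * (1 + (defect v)%:R)))).
  apply: mean_le => v vN; rewrite mulN1r; apply: le_trans (heat_lipschitz _ _ _) _.
  have -> : 2 * rsqrt e * eta * (1 + (defect v)%:R)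
    = rsqrt e * (eta * (2 * (1 + (defect v)%:R))) by ring.
  rewrite ler_wpM2l // opprB addrC addrA subrK -mulrBr normrM (ger0_norm (ltW eta0)).
  apply: (ler_wpM2l (ltW eta0)); rewrite -vN.
  have -> : height (Normal ord0 [::] 0) = 0 by [].
  by rewrite add0r distrC; exact: gain_centered.
rewrite meanZ meanD mean_cst.
have -> : rsqrt e * 74 * eta = 2 * rsqrt e * eta * 37 by ring.
apply: ler_wpM2l; last by have := mean_defect R N; lra.
by rewrite -mulrA mulr_ge0 // mulr_ge0 // ltW.
Qed.

Lemma rsqrt_near1 (e : R) : 0 <= e -> 1 - e <= rsqrt (1 + e) <= 1.
Proof.
move=> e0; have e1 : 1 <= 1 + e by rewrite lerDl.
have /andP[r0 r1] := rsqrt_le ltr01 e1; rewrite /rsqrt sqrtr1 invr1 in r1 *.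
rewrite r1 andbT; have s1 : 1 <= Num.sqrt (1 + e) by rewrite -[leLHS]sqrtr1 ler_wsqrtr.
have s2 : Num.sqrt (1 + e) <= 1 + e.
  have : Num.sqrt (1 + e) ^+ 2 = 1 + e by rewrite sqr_sqrtr //; lra.
  by rewrite expr2; nra.
rewrite -[leRHS]mul1r ler_pdivlMr; last by lra.
by nra.
Qed.

Lemma heat_near1 (e c : R) : 0 <= e -> `|heat (1 + e) c - Phi c| <= `|c| * e.
Proof.
move=> e0; apply: le_trans (Phi_lipschitz _ _) _.
have -> : c * rsqrt (1 + e) - c = c * (rsqrt (1 + e) - 1) by ring.
rewrite normrM ler_wpM2l //; have := rsqrt_near1 e0 => /andP[h1 h2].
by rewrite ler_norml; lra.
Qed.

Section Sandwich.
Variables (theta a b x y : R).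
Hypotheses (theta0 : 0 < theta) (ab : a <= b) (xy : `|y - x| <= theta).
Let U c : R := heat (theta ^+ 4) (c - x).
Let kappa : R := 1 - Phi theta^-1 + Phi (- theta^-1).

Lemma rsqrt_theta : rsqrt (theta ^+ 4) = theta^-1 * theta^-1.
Proof.
rewrite /rsqrt -[4%N]/(2 * 2)%N exprM sqrtr_sqr ger0_norm ?sqr_ge0 //.
by rewrite expr2 invfM.
Qed.

Lemma heat_above c : theta <= c -> Phi theta^-1 <= heat (theta ^+ 4) c.
Proof.
move=> tc; apply: Phi_homo; rewrite rsqrt_theta mulrA; apply: ler_peMl.
  by rewrite invr_ge0 ltW.
by rewrite ler_pdivlMr // mul1r.
Qed.

Lemma heat_below c : c <= - theta -> heat (theta ^+ 4) c <= Phi (- theta^-1).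
Proof.
move=> tc; apply: Phi_homo; rewrite rsqrt_theta mulrA lerNr -mulNr -mulNr.
apply: ler_peMl; first by rewrite invr_ge0 ltW.
by rewrite ler_pdivlMr // mul1r lerNr.
Qed.

Lemma heat_homo (e : R) : {homo heat e : c c' / c <= c'}.
Proof.
by move=> c c' cc; apply: Phi_homo; rewrite ler_wpM2r // invr_ge0 sqrtr_ge0.
Qed.

(** A kernel of variance [theta ^+ 4] has width [theta ^+ 2], so it carries the
jumps of the indicator within [theta]; [kappa] is the mass that escapes beyond
[theta ^-1] standard deviations. *)
Lemma indicator_le : (a <= y <= b)%R%:R <= U (b + 2 * theta) - U (a - 2 * theta) + kappa.
Proof.
have k0 : 0 <= kappa by have := Phi_le1 theta^-1; have := Phi_ge0 (- theta^-1);
  rewrite /kappa; lra.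
have /andP[x1 x2] : - theta <= y - x <= theta by rewrite -ler_norml.
case: (boolP (a <= y <= b)) => [/andP[ay yb]|_].
  have h1 : Phi theta^-1 <= U (b + 2 * theta) by apply: heat_above; lra.
  have h2 : U (a - 2 * theta) <= Phi (- theta^-1) by apply: heat_below; lra.
  by rewrite /kappa /=; lra.
have h : U (a - 2 * theta) <= U (b + 2 * theta).
  by apply: heat_homo; move: ab theta0; lra.
by rewrite /=; lra.
Qed.

Lemma indicator_ge : U (b - 2 * theta) - U (a + 2 * theta) - kappa <= (a <= y <= b)%R%:R.
Proof.
have p1 : U (b - 2 * theta) <= 1 by exact: Phi_le1.
have p0 : 0 <= U (a + 2 * theta) by exact: Phi_ge0.
have q1 := Phi_le1 theta^-1; have q0 := Phi_ge0 (- theta^-1).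
have /andP[x1 x2] : - theta <= y - x <= theta by rewrite -ler_norml.
have [ay|ya] := leP a y; last first.
  have h : Phi theta^-1 <= U (a + 2 * theta) by apply: heat_above; lra.
  by rewrite /kappa /=; lra.
have [yb|yb] := leP y b; first by rewrite /kappa /=; lra.
have h : U (b - 2 * theta) <= Phi (- theta^-1) by apply: heat_below; lra.
by rewrite /kappa /=; lra.
Qed.

End Sandwich.

Definition scale (N : nat) : R := (Num.sqrt V * Num.sqrt N%:R)^-1.

Lemma scale_bounds N : (0 < N)%N ->
  0 < scale N <= 5 /\ V * scale N ^+ 2 * N%:R = 1.
Proof.
move=> N0; have V0 := variance_gt0 R; have /andP[V1 _] := variance_bounds R.
have N1 : 1 <= N%:R :> R by rewrite ler1n.
have sV : 0 < Num.sqrt V by rewrite sqrtr_gt0.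
have sN : 0 < Num.sqrt N%:R :> R by rewrite sqrtr_gt0; lra.
have sV2 : Num.sqrt V ^+ 2 = V by rewrite sqr_sqrtr // ltW.
have sN2 : Num.sqrt N%:R ^+ 2 = N%:R :> R by rewrite sqr_sqrtr //; lra.
split; last by rewrite /scale -{1}sV2 -{2}sN2; field; rewrite !gt_eqF.
rewrite invr_gt0 mulr_gt0 //= -[5]invrK lef_pV2 ?posrE ?mulr_gt0 ?invr_gt0 //.
have h1 : 1 / 5 <= Num.sqrt V by rewrite expr2 in sV2; nra.
have h2 : 1 <= Num.sqrt N%:R :> R by rewrite expr2 in sN2; nra.
by nra.
Qed.

Lemma scale_small (d : R) : 0 < d -> exists N0, forall N, (N0 <= N)%N ->
  (0 < N)%N /\ scale N <= d.
Proof.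
move=> d0; have V0 := variance_gt0 R.
have [N0 hN0] : exists N0, (V * d ^+ 2)^-1 <= N0%:R.
  exists (Num.truncn (V * d ^+ 2)^-1).+1; apply: ltW; exact: truncnS_gt.
exists N0.+1 => N N0N; split; first exact: leq_trans N0N.
have N1 : (0 < N)%N by exact: leq_trans N0N.
have [/andP[s0 _] scaling] := scale_bounds N1.
have hN : (V * d ^+ 2)^-1 <= N%:R.
  by apply: le_trans hN0 _; rewrite ler_nat (leq_trans _ N0N).
have Vd : 0 < V * d ^+ 2 by rewrite mulr_gt0 // exprn_gt0.
have : V * scale N ^+ 2 * N%:R <= V * d ^+ 2 * N%:R.
  by rewrite scaling -ler_pdivrMl // mulr1.
rewrite ler_pM2r ?ltr0n // ler_pM2l //.
by rewrite ler_pXn2r // nnegrE ltW.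
Qed.

(** Stated for any statistic of words that is within a constant of the height:
a bounded perturbation is killed by the scaling. *)
Theorem letter_clt (T : seq bool -> R) (K a b : R) : a <= b ->
  (forall s, `|T s - (word_height s)%:~R| <= K) ->
  forall eps : R, 0 < eps -> exists N0, forall N, (N0 <= N)%N ->
  `|mean N (fun s => (a <= scale N * (T s - speed R * N%:R) <= b)%R%:R)
    - (Phi b - Phi a)| <= eps.
Proof.
move=> ab TK eps eps0.
have K0 : 0 <= K by apply: le_trans (TK [::]).
have [M HM] : exists M, forall x, M <= x -> 1 - Phi x + Phi (- x) <= eps / 4.
  by apply: Phi_tails; lra.
(* The smoothing costs [A * theta] and the tails beyond [theta ^-1], hence
   the two constraints on [theta]; [eta] is made small afterwards. *)
pose A := `|a| + `|b| + 8.
have a0 : 0 <= `|a| by [].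
have b0 : 0 <= `|b| by [].
have A8 : 8 <= A by rewrite /A; lra.
pose D := 1 + `|M| + 4 * A / eps; have D1 : 1 + `|M| <= D.
  by rewrite /D lerDl divr_ge0 //; lra.
have M0 : 0 <= `|M| by [].
pose theta := D^-1.
have t0 : 0 < theta by rewrite invr_gt0; lra.
have t1 : theta <= 1 by rewrite invf_le1; lra.
have tM : M <= theta^-1 by rewrite invrK; have := ler_norm M; lra.
have tA : A * theta <= eps / 4.
  rewrite ler_pdivrMr; last by lra.
  rewrite /D mulrDr; have -> : eps / 4 * (4 * A / eps) = A.
    by field; rewrite gt_eqF.
  by rewrite lerDr mulr_ge0 //; lra.
have e0 : 0 < theta ^+ 4 by rewrite exprn_gt0.
have te : theta ^+ 4 <= theta.
  by rewrite exprS ler_piMr ?exprn_ile1 // ltW.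
have [C C0 clt] := height_clt e0.
pose d := Num.min (theta / (K + 1)) (eps / (8 * (C + 1))).
have d0 : 0 < d by rewrite lt_min !divr_gt0 ?mulr_gt0 //; lra.
have [N0 hN0] := scale_small d0; exists N0 => N /hN0[N1 sd].
have [eb scaling] := scale_bounds N1; have /andP[eta0 _] := eb.
set eta := scale N in eb scaling eta0 sd *.
have sK : eta * K <= theta.
  move: sd; rewrite le_min => /andP[+ _]; rewrite ler_pdivlMr; last by lra.
  by apply: le_trans; rewrite ler_wpM2l ?lerDl // ltW.
have sC : C * eta <= eps / 8.
  move: sd; rewrite le_min => /andP[_]; rewrite ler_pdivlMr; last by lra.
  by nra.
have near s : `|eta * (T s - speed R * N%:R)
    - eta * ((word_height s)%:~R - speed R * N%:R)| <= theta.
  rewrite -mulrBr opprB addrA subrK normrM (ger0_norm (ltW eta0)).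
  by apply: le_trans sK; rewrite ler_wpM2l // ltW.
have tail : 1 - Phi theta^-1 + Phi (- theta^-1) <= eps / 4 by exact: HM.
set F := fun s => _%:R.
pose H c := mean N (fun s => heat (theta ^+ 4)
  (c - eta * ((word_height s)%:~R - speed R * N%:R))).
have Hc c c0 : `|c - c0| <= 2 * theta -> `|H c - Phi c0| <= eps / 8 + (`|c0| + 4) * theta.
  move=> cc; have -> : H c - Phi c0
    = (H c - heat (1 + theta ^+ 4) c) + (heat (1 + theta ^+ 4) c - Phi c)
      + (Phi c - Phi c0) by ring.
  have h1 : `|H c - heat (1 + theta ^+ 4) c| <= eps / 8.
    by apply: le_trans sC; exact: clt.
  have h2 : `|heat (1 + theta ^+ 4) c - Phi c| <= (`|c0| + 2) * theta.
    apply: le_trans (heat_near1 c (ltW e0)) _; apply: ler_pM => //; first exact: ltW.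
    have -> : c = c0 + (c - c0) by ring.
    by apply: le_trans (ler_normD _ _) _; rewrite lerD2l (le_trans cc); lra.
  have h3 := le_trans (Phi_lipschitz c c0) cc.
  apply: le_trans (ler_normD _ _) _; apply: le_trans (lerD (ler_normD _ _) (lexx _)) _.
  have -> : (`|c0| + 4) * theta = (`|c0| + 2) * theta + 2 * theta by ring.
  by lra.
have up : mean N F <= H (b + 2 * theta) - H (a - 2 * theta) + eps / 4.
  rewrite /H -[- mean N _]mulN1r -meanZ -meanD -[eps / 4](mean_cst N) -meanD.
  apply: mean_le => s _; apply: le_trans (indicator_le t0 ab (near s)) _.
  by rewrite mulN1r lerD2l.
have dn : H (b - 2 * theta) - H (a + 2 * theta) - eps / 4 <= mean N F.
  rewrite /H -[- mean N _]mulN1r -meanZ -meanD -[- (eps / 4)](mean_cst N) -meanD.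
  apply: mean_le => s _; apply: le_trans _ (indicator_ge a b t0 (near s)).
  by rewrite mulN1r lerD2l lerN2.
have n1 : `|2 * theta| <= 2 * theta by rewrite ger0_norm //; lra.
have := Hc (b + 2 * theta) b; rewrite [b + _ - b]addrAC subrr add0r => /(_ n1).
have := Hc (a - 2 * theta) a; rewrite [a - _ - a]addrAC subrr add0r normrN => /(_ n1).
have := Hc (b - 2 * theta) b; rewrite [b - _ - b]addrAC subrr add0r normrN => /(_ n1).
have := Hc (a + 2 * theta) a; rewrite [a + _ - a]addrAC subrr add0r => /(_ n1).
have tAE : A * theta = (`|a| + 4) * theta + (`|b| + 4) * theta by rewrite /A; ring.
rewrite tAE in tA.
move: tA up dn; move: (mean N F) (H _) (H _) (H _) (H _) ((`|a| + 4) * theta)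
  ((`|b| + 4) * theta) (Phi a) (Phi b) => m h1 h2 h3 h4 ta tb pa pb.
clear -eps0; rewrite !ler_norml.
by move=> ? ? ? /andP[? ?] /andP[? ?] /andP[? ?] /andP[? ?]; lra.
Qed.

End LetterCLT.

(** * The law of the random braid *)

Section Letters.

Lemma height_push x i : height x <= height (push x i).
Proof.
case: x => a [|e s] j; rewrite /push /height /=; first by lia.
case: ifP => _ /=; first by lia.
by case: e => /=; lia.
Qed.

Lemma height_run_ge0 s : 0 <= height (run (Normal ord0 [::] 0) s).
Proof.
suff H x : 0 <= height x -> 0 <= height (run x s) by exact: H.
elim: s x => [//|i s IH] x x0 /=; apply: IH; exact: le_trans (height_push x i).
Qed.

Definition swap (c : letter) (t : nat * nat * nat) :=
  if c.1 == ord0 then (t.1.2, t.1.1, t.2) else (t.1.1, t.2, t.1.2).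

(** The permutation of the strands, as an action on triples, is an invariant of the
braid; it is used to tell the two generators apart. *)
Lemma swap_braid u v : braid_equiv u v -> forall t, foldr swap t u = foldr swap t v.
Proof.
elim=> {u v} [//|u v _ IH|u v w _ IHu _ IHv|u u' v v' _ IHu _ IHv|i b|] t //.
- by rewrite IHu IHv.
- by rewrite !foldr_cat IHu IHv.
- by case: t => -[x y] z; have [->|->] := ordP i.
Qed.

Lemma gen_neq : gen ord0 != gen ord_max.
Proof. by apply/eqP => /braidP/swap_braid/(_ (0, 1, 2))%N. Qed.

Lemma braid_surj (y : Br3) : exists u, braid u = y.
Proof. by exists (generic_quotient.repr y); exact: braid_reprK. Qed.

Definition letters (s : seq bool) : word := [seq (bit_letter c, true) | c <- s].

End Letters.

Section Law.
Variables (R : realType) (d : measure_display) (T : measurableType d).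
Variables (P : probability T R) (g : nat -> {RV P >-> Br3}).
Hypothesis g_indep : mutually_independent g.
Hypothesis g_unif : forall i, uniform_on_pair sigma1 sigma2 (g i).
Local Notation walk := (random_product (fun i => g i : T -> Br3)).

Lemma measurable_step i (A : set Br3) : measurable (g i @^-1` A).
Proof. by rewrite -[_ @^-1` _]setTI; apply: measurable_funP. Qed.

Lemma walkS n t : walk n.+1 t = (walk n t * g n t)%g.
Proof. by rewrite /random_product big_ord_recr. Qed.

(** The braid group is countable, so that the law of a product of two random
elements decomposes over the values of the first one. *)
Lemma measurable_walk n (A : set Br3) : measurable [set t | A (walk n t)].
Proof.
elim: n A => [|n IH] A.
  rewrite (_ : [set t | _] = [set t : T | A 1%g]); last first.
    by apply/seteqP; split=> t; rewrite /= /random_product big_ord0.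
  by have [/propT ->|/propF ->] := pselect (A 1%g); [exact: measurableT|exact: measurable0].
(* an enumeration of the group, with repetitions, by codes of words *)
pose x k : Br3 := braid (odflt [::] (unpickle k : option (seq ('I_2 * bool)))).
rewrite (_ : [set t | _] = \bigcup_k ([set t | walk n t = x k]
    `&` g n @^-1` [set y | A (x k * y)%g])).
  apply: bigcup_measurable => k _; apply: measurableI; last exact: measurable_step.
  exact: (IH [set y | y = x k]).
apply/seteqP; split=> t /=.
  rewrite walkS => At.
  have [k xE] : exists k, x k = walk n t.
    have [u <-] := braid_surj (walk n t); exists (pickle (u : seq ('I_2 * bool))).
    by rewrite /x pickleK.
  exists k => //.
  by split; rewrite /= xE.
by move=> [k _ [/= wk At]]; rewrite walkS wk.
Qed.

Lemma step_prob i c : P (g i @^-1` [set gen (bit_letter c)]) = (2^-1)%:E.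
Proof.
rewrite -[LHS]/(distribution P (g i) _) g_unif // !diracE.
have ne : gen ord_max <> gen ord0 by apply/eqP; rewrite eq_sym gen_neq.
case: c; rewrite /= (mem_set (erefl _ : [set gen _] _)) memNset /=;
  rewrite ?adde0 ?add0e ?mule1 //.
by move=> h; apply: ne.
Qed.

Definition cylinder (s : seq bool) : set T :=
  \bigcap_(j in [set` iota 0 (size s)]) g j @^-1` [set gen (bit_letter (nth true s j))].

Lemma cylinder_prob s : P (cylinder s) = (2^-1 ^+ size s)%:E.
Proof.
rewrite /cylinder g_indep ?iota_uniq //.
under eq_bigr do rewrite step_prob.
by rewrite prodEFin big_const_seq count_predT size_iota -Monoid.iteropE.
Qed.

Lemma measurable_cylinder s : measurable (cylinder s).
Proof.
by apply: bigcap_measurableType => // j _; exact: measurable_step.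
Qed.

Lemma cylinder_rcons s c :
  cylinder (rcons s c) = cylinder s `&` g (size s) @^-1` [set gen (bit_letter c)].
Proof.
apply/seteqP; split=> t /=.
  move=> h; split=> [j /= js|].
    have := h j; rewrite /= mem_iota size_rcons nth_rcons.
    move: js; rewrite mem_iota /= add0n => js.
    by rewrite js => ->//; rewrite leqW.
  have := h (size s); rewrite /= mem_iota size_rcons nth_rcons ltnn eqxx.
  by rewrite add0n leqnn; apply.
move=> [h hs] j /=; rewrite mem_iota size_rcons nth_rcons /= add0n ltnS leq_eqVlt.
move=> /orP[/eqP->|js]; first by rewrite ltnn eqxx.
by rewrite js; apply: h; rewrite /= mem_iota.
Qed.

Lemma cylinder_walk s t : cylinder s t -> walk (size s) t = braid (letters s).
Proof.
elim/last_ind: s => [|s c IH]; first by rewrite /random_product big_ord0.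
rewrite cylinder_rcons size_rcons walkS => -[/IH -> ->].
by rewrite /letters map_rcons -cats1 braid_catE.
Qed.

Lemma step_other i : P (g i @^-1` ~` [set gen ord0; gen ord_max]) = 0.
Proof.
rewrite -[LHS]/(distribution P (g i) _) g_unif // !diracE !memNset; last 2 first.
- by move=> /(_ (or_intror erefl)).
- by move=> /(_ (or_introl erefl)).
by rewrite adde0 mule0.
Qed.

(** Induction on the number [m] of letters that have not been fixed by the cylinder:
the next one is one of the two generators almost surely. *)
Lemma law_cylinder m s (A : set Br3) :
  P (cylinder s `&` [set t | A (walk (size s + m) t)])
  = (2^-1 ^+ size s * mean m (fun v => `[< A (braid (letters (s ++ v))) >]%:R))%:E.
Proof.
elim: m s => [|m IH] s.
  rewrite addn0 /= cats0.
  rewrite (_ : _ `&` _ = cylinder s `&` [set t : T | A (braid (letters s))]); last first.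
    by apply/seteqP; split=> t [] h; rewrite /= (cylinder_walk h).
  have [As|As] := pselect (A (braid (letters s))).
    rewrite (propT As) asboolT // mulr1 -cylinder_prob; congr (P _).
    by apply/seteqP; split=> // t [].
  rewrite (propF As) asboolF // mulr0 -[RHS](measure0 P); congr (P _).
  by apply/seteqP; split=> // t [].
set E := _ `&` _; pose B c := g (size s) @^-1` [set gen (bit_letter c)].
have mB c : measurable (B c) by exact: measurable_step.
have mE : measurable E.
  by apply: measurableI (measurable_cylinder _) (measurable_walk _ _).
have split c : E `&` B c
    = cylinder (rcons s c) `&` [set t | A (walk (size (rcons s c) + m) t)].
  by rewrite cylinder_rcons size_rcons addSnnS setIAC.
have total : P E = (P (E `&` B false) + P (E `&` B true))%E.
  rewrite (measureDI P mE (mB true)); congr (_ + _)%E.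
  rewrite (measureDI P (measurableD mE (mB true)) (mB false)) -[RHS]add0e.
  congr (_ + _)%E; last first.
    congr (P _); apply/seteqP; split=> t; first by move=> [[]].
    move=> [Et Bt]; split=> //; split=> // Bt'; case/eqP: gen_neq.
    by rewrite -[LHS]Bt' -[RHS]Bt.
  apply/eqP; rewrite -measure_le0 -(step_other (size s)).
  apply: le_measure; rewrite ?inE; try exact: measurable_step.
    by apply: measurableD => //; apply: measurableD.
  by move=> t [[_ h1] h2] [h|h]; [apply: h1|apply: h2].
have IHc c : P (E `&` B c) = (2^-1 ^+ (size s).+1
    * mean m (fun v => `[< A (braid (letters (s ++ c :: v))) >]%:R))%:E.
  rewrite split IH size_rcons; congr (_ * _)%:E.
  by apply: mean_ext => v _; rewrite cat_rcons.
rewrite total (IHc false) (IHc true) -EFinD; congr EFin.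
by rewrite exprSr -mulrDr -mulrA [2^-1 * _]mulrC /= addrC.
Qed.

(** Reduces probabilities to counting bit strings. *)
Theorem walk_law n (A : set Br3) : P [set t | A (walk n t)]
  = (mean n (fun v => `[< A (braid (letters v)) >]%:R))%:E.
Proof.
have := law_cylinder n [::] A; rewrite expr0 mul1r add0n => <-; congr (P _).
by apply/seteqP; split=> [t At|t []//]; split=> // j.
Qed.

End Law.

(** * Conclusion *)

(** The height of a positive word is nonnegative, which determines the sign of the
signature and disposes of the absolute value. *)
Lemma closure_height (C : numClosedFieldType) : exists K : int, forall s : seq bool,
  `| `|closure_signature (braid (letters s)) (-1 : C)| - word_height s| <= K.
Proof.
have [K hK] := sig_run C; exists (8 + K) => s.
have h0 := height_run_ge0 (map bit_letter s); rewrite -/(word_height s) in h0.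
set x := braid _; pose u := generic_quotient.repr x.
have us : braid_equiv u [seq (i, true) | i <- map bit_letter s].
  by rewrite -map_comp; exact: repr_braidP.
have := hK u _ us; rewrite -/(word_height s) => h1.
have h2 := word_signature_sig C u.
rewrite /closure_signature -/u; move: h0 h1 h2; move: (word_height s) (sig C u) => h g.
by move: (word_signature u _) => a; lia.
Qed.

Theorem theorem1p5 (R : realType) (d : measure_display) (T : measurableType d)
    (P : probability T R) (g : nat -> {RV P >-> Br3})
    (g_indep : mutually_independent g)
    (g_unif : forall i, uniform_on_pair sigma1 sigma2 (g i)) :
  let w := random_product (fun i => g i : T -> Br3) in
  let ell0 : R := (5 - Num.sqrt 5) / 4 in
  let sig (n : nat) (t : T) : int := closure_signature (w n t) (- 1 : R[i]) in
  exists nu0 : R, 0 < nu0 /\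
    forall a b : R, a < b ->
      P [set t | a <= (`|sig n t|%:~R - ell0 * n%:R) / (nu0 * Num.sqrt n%:R) <= b]
        @[n --> \oo] -->
      ((Num.sqrt (2 * pi))^-1
        * \int[lebesgue_measure]_(t in `[a, b]) expR (- (t ^+ 2) / 2))%:E.
Proof.
move=> w ell0 sig; exists (Num.sqrt (variance R)); split.
  by rewrite sqrtr_gt0 variance_gt0.
move=> a b ab; have [K hK] := closure_height (R[i] : numClosedFieldType).
pose f s : R := `|closure_signature (braid (letters s)) (-1 : R[i])|%:~R.
have near s : `|f s - (word_height s)%:~R| <= K%:~R.
  by rewrite /f -intrB -intr_norm ler_int.
have ell0E : ell0 = speed R by rewrite /ell0 /speed /rho; field.
have lawE n : P [set t | a <= (`|sig n t|%:~R - ell0 * n%:R)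
      / (Num.sqrt (variance R) * Num.sqrt n%:R) <= b]
    = (mean n (fun s => (a <= scale R n * (f s - speed R * n%:R) <= b)%R%:R))%:E.
  pose A := [set x | a <= scale R n
    * (`|closure_signature x (-1 : R[i])|%:~R - speed R * n%:R) <= b].
  transitivity (P [set t | A (w n t)]).
    by congr (P _); apply/funext => t; rewrite /A /= /scale ell0E mulrC.
  rewrite (walk_law g_indep g_unif); congr EFin; apply: mean_ext => s _.
  by rewrite /A /= asboolb.
under eq_cvg do rewrite lawE.
apply: cvg_EFin; first by near=> n.
rewrite -Phi_sub; last exact: ltW.
apply/cvgrPdist_le => eps eps0.
have [N0 hN0] := letter_clt (ltW ab) near eps0.
near=> n; rewrite /= distrC; apply: hN0; near: n; exact: nbhs_infty_ge.
Unshelve. all: by end_near.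
Qed.
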